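(* Let $\epsilon>0$ and $\beta:=(\alpha\wedge 2)^{-1}$. Let $Z(n,b):=Z_{\rm dom}(n,b)+Z_{\rm res}(n,b)$, where $Z_{\rm dom}(n,b)$ and $Z_{\rm res}(n,b)$ are generated independently, from the measures $\mathbb{P}_1$ and $\mathbb{P}_2$ respectively. Under Assumption 1 (stated in the context), the family of estimators $(Z(n,b): n\ge 1,\ b>n^{\beta+\epsilon})$ achieves asymptotically vanishing relative error for the estimation of $\mathbb{P}\{S_n>b\}$ as $n\nearrow\infty$; that is, $$\sup_{b>n^{\beta+\epsilon}}\frac{\mathrm{Var}_{n,b}[Z(n,b)]}{\mathbb{P}\{S_n>b\}^2}=o(1)\quad\text{as } n\nearrow\infty .$$
   Context: $X,X_1,X_2,\dots$ are i.i.d. real random variables with distribution function $F$, $\mathbb{E}X=0$, under a probability measure $\mathbb{P}$. $S_0=0$, $S_n=X_1+\dots+X_n$. Assumption 1: $\bar F(x):=\mathbb{P}\{X>x\}=x^{-\alpha}L(x)$ for some $\alpha>1$ and some slowly varying function $L$ (i.e. $L(tx)/L(x)\to1$ as $x\to\infty$ for every $t>0$). Further, if $\mathrm{Var}[X]=\infty$, then $\limsup_{x\to\infty}\mathbb{P}\{X<-x\}/\mathbb{P}\{X>x\}<\infty$. Events: $A_{\rm dom}(n,b):=\{S_n>b,\ \max_{k\le n}X_k\ge b\}$, $A_{\rm res}(n,b):=\{S_n>b,\ \max_{k\le n}X_k<b\}$. Measure $\mathbb{P}_1$ (depending on $n,b$): choose an index $I$ uniformly at random from $\{1,\dots,n\}$;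 then, independently for $k=1,\dots,n$, generate $X_k$ from $F(\cdot\mid X_k\ge b)$ if $k=I$ and from $F$ otherwise. The estimator generated under $\mathbb{P}_1$ is $$Z_{\rm dom}(n,b):=\frac{n\bar F(b)}{\#\{1\le i\le n: X_i\ge b\}}\,\mathbb{I}(A_{\rm dom}(n,b)).$$ Measure $\mathbb{P}_2$ (depending on $n,b$): let $\Lambda_b(\theta):=\log\int_{-\infty}^b e^{\theta x}F(dx)$ for $\theta\ge0$ and $\theta_{n,b}:=-\log(n\bar F(b))/b$ (which is positive for all $b>n^{\beta+\epsilon}$ once $n$ is large). Under $\mathbb{P}_2$ the increments $X_1,\dots,X_n$ are i.i.d. with law $F_\theta$ given by $\frac{dF_\theta(x)}{dF(x)}=\exp(\theta_{n,b}x-\Lambda_b(\theta_{n,b}))\mathbf 1(x<b)$. The estimator generated under $\mathbb{P}_2$ is $$Z_{\rm res}(n,b):=\exp\big(-\theta_{n,b}S_n+n\Lambda_b(\theta_{n,b})\big)\,\mathbb{I}(A_{\rm res}(n,b)).$$ $\mathrm{Var}_{n,b}$ denotes variance under the composite procedure of drawing $Z_{\rm dom}(n,b)$ and $Z_{\rm res}(n,b)$ independently from $\mathbb{P}_1$ and $\mathbb{P}_2$ respectively. *)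

(* Defs.v *)
From HB Require Import structures.
From mathcomp Require Import all_boot all_order all_algebra.
From mathcomp Require Import all_classical all_reals all_analysis.
From mathcomp Require Import measurable_realfun.

Set Implicit Arguments.
Unset Strict Implicit.
Unset Printing Implicit Defensive.

Import Order.TTheory GRing.Theory Num.Theory.
Import numFieldNormedType.Exports.

Local Open Scope classical_set_scope.
Local Open Scope ring_scope.

Section iid.
Context {d : measure_display} {T : measurableType d} {R : realType}.
Variables (P : probability T R) (X : nat -> {RV P >-> R}).

Definition mutually_independent : Prop :=
  forall (J : seq nat) (A : nat -> set R), uniq J ->
    (forall k, measurable (A k)) ->
    P (\big[setI/setT]_(k <- J) (X k @^-1` A k)) =
    (\prod_(k <- J) P (X k @^-1` A k))%E.

Definition identically_distributed : Prop :=
  forall (k : nat) (A : set R), measurable A ->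
    P (X k @^-1` A) = P (X 0%N @^-1` A).

Definition iid : Prop := mutually_independent /\ identically_distributed.

(* The sequence X_1, X_2, ... is indexed from 0: S_n = X 0 + ... + X n.-1. *)
Definition partial_sum (n : nat) (w : T) : R := \sum_(k < n) X k w.

End iid.

Definition slowly_varying {R : realType} (L : R -> R) : Prop :=
  forall t : R, 0 < t -> L (t * x) / L x @[x --> +oo] --> (1 : R).

(* A measure of total mass 1, bundled as a probability.  Measures of mass 0 or
   +oo are sent to a dummy Dirac mass and other masses are rescaled; neither
   happens in the cases of interest, see [as_probabilityE]. *)
Section as_probability.
Context {d : measure_display} {T : measurableType d} {R : realType}.

Definition as_probability (m : {measure set T -> \bar R}) : probability T R :=
  mnormalize m (dirac point).

Lemma as_probabilityE (m : {measure set T -> \bar R}) (A : set T) :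
  m setT = 1%E -> as_probability m A = m A.
Proof.
move=> m1; rewrite /as_probability/= /mnormalize m1.
by rewrite onee_eq0/= invr1 mule1.
Qed.

End as_probability.

Section product_probability.
Context {d1 d2 : measure_display} {T1 : measurableType d1}
  {T2 : measurableType d2} {R : realType}.
Variables (m1 : probability T1 R) (m2 : probability T2 R).
Local Open Scope ereal_scope.

Let product_setT : (m1 \x m2) setT = 1.
Proof.
rewrite -setXTT product_measure1E//.
by rewrite -[RHS]mule1; congr (_ * _); exact: probability_setT.
Qed.

HB.instance Definition _ :=
  Measure_isProbability.Build _ _ _ (m1 \x m2) product_setT.

End product_probability.

Section tuple_law.
Context {d : measure_display} {U : measurableType d} {R : realType}.

Definition tcons {n : nat} (z : U * n.-tuple U) : n.+1.-tuple U :=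
  [tuple of z.1 :: z.2].

Lemma measurable_tcons n : measurable_fun setT (@tcons n).
Proof. exact: measurable_cons. Qed.

HB.instance Definition _ n := isMeasurableFun.Build _ _ _ _ (@tcons n)
  (@measurable_tcons n).

(* The law of (Y_0, ..., Y_(n-1)) for independent Y_k ~ mu k. *)
Fixpoint product_law (n : nat) (mu : nat -> probability U R) :
    probability (n.-tuple U) R :=
  match n with
  | 0 => dirac [tuple]
  | m.+1 => distribution (mu 0%N \x product_law m (fun k => mu k.+1))%E tcons
  end.

End tuple_law.

Section samplers.
Context {R : realType}.
(* F is both the distribution function and the law of an increment. *)
Variable F : probability R R.

Definition tail (x : R) : R := fine (F `]x, +oo[%classic).

(* F( . | X >= b), with the dummy value F when that event has mass 0. *)
Definition cond_ge (b : R) : probability R R :=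
  mnormalize (mrestr F (measurable_itv `[b, +oo[)) F.

(* The summand i is the joint law given that the uniform index I equals i. *)
Definition mixture (n : nat) (b : R) : {measure set (n.-tuple R) -> \bar R} :=
  mscale (n%:R^-1)%:nng
    (msum (fun i => product_law n (fun k => if k == i then cond_ge b else F)) n).

Definition P1 (n : nat) (b : R) : probability (n.-tuple R) R :=
  as_probability (mixture n b).

(* The integral runs over the open half-line x < b, so that it also normalises
   the tilted law below when F has an atom at b. *)
Definition Lambda (b theta : R) : R :=
  ln (\int[F]_(x in `]-oo, b[) expR (theta * x))%R.

Definition theta (n : nat) (b : R) : R := - ln (n%:R * tail b) / b.

Definition tilt_density (b th x : R) : R :=
  expR (th * x - Lambda b th) * \1_(`]-oo, b[%classic) x.

Definition tilted (b th : R) (A : set R) : \bar R :=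
  (\int[F]_(x in A) (tilt_density b th x)%:E)%E.

Lemma tilt_density_ge0 b th x : 0 <= tilt_density b th x.
Proof. by rewrite mulr_ge0// expR_ge0. Qed.

Lemma measurable_tilt_density b th : measurable_fun setT (tilt_density b th).
Proof.
apply: measurable_funM; last exact: measurable_indic.
apply: measurableT_comp; first exact: measurable_expR.
by apply: measurable_funB => //; exact: mulrl_measurable.
Qed.

Section tilted_measure.
Variables b th : R.

Let tilted0 : tilted b th set0 = 0%E.
Proof. exact: integral_set0. Qed.

Let tilted_ge0 A : (0 <= tilted b th A)%E.
Proof. by apply: integral_ge0 => x _; rewrite lee_fin tilt_density_ge0. Qed.

Let tilted_sigma_additive : semi_sigma_additive (tilted b th).
Proof.
move=> A mA tA mUA; rewrite /tilted ge0_integral_bigcup//.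
- by apply: is_cvg_ereal_nneg_natsum => k _; exact: tilted_ge0.
- apply/measurable_EFinP; apply: measurable_funTS.
  exact: measurable_tilt_density.
- by move=> x _; rewrite lee_fin tilt_density_ge0.
Qed.

HB.instance Definition _ := isMeasure.Build _ _ _ (tilted b th)
  tilted0 tilted_ge0 tilted_sigma_additive.

End tilted_measure.

Definition P2 (n : nat) (b : R) : probability (n.-tuple R) R :=
  product_law n (fun=> as_probability (tilted b (theta n b))).

Lemma tilted_setT (b th : R) : 0 <= th -> (0 < F `]-oo, b[%classic)%E ->
  tilted b th setT = 1%E.
Proof.
move=> th0 Fb; set D := `]-oo, b[%classic.
have mD : measurable D by exact: measurable_itv.
have me : measurable_fun setT (fun x : R => (expR (th * x))%:E).
  apply/measurable_EFinP; apply: measurableT_comp; first exact: measurable_expR.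
  exact: mulrl_measurable.
set I := (\int[F]_(x in D) (expR (th * x))%:E)%E.
have I0 : (0 < I)%E.
  rewrite lt_neqAle integral_ge0 ?andbT; last first.
    by move=> x _; rewrite lee_fin expR_ge0.
  apply/negP => /eqP I0.
  have : (\int[F]_(x in D) `|(expR (th * x))%:E|)%E = 0%E.
    rewrite [RHS]I0; apply: eq_integral => x _.
    by rewrite gee0_abs// lee_fin expR_ge0.
  move/(ae_eq_integral_abs F mD (measurable_funTS me)) => [N [mN FN0 DN]].
  have : (F D <= F N)%E.
    apply: le_measure; rewrite ?inE// => x Dx; apply: DN => /= /(_ Dx)/= [].
    by apply/eqP; rewrite gt_eqF// expR_gt0.
  by rewrite FN0 leNgt Fb.
have Ioo : (I < +oo)%E.
  apply: (@le_lt_trans _ _ (\int[F]_(x in D) (cst (expR (th * b))%:E) x)%E).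
    apply: ge0_le_integral => //.
    - exact: measurable_funTS.
    - move=> x; rewrite /D/= in_itv/= => xb.
      by rewrite lee_fin ler_expR ler_wpM2l// ltW.
  rewrite integral_cst//; apply: lte_mul_pinfty => //.
  - by apply: le_lt_trans (ltry 1); exact: probability_le1.
have IE : I = (fine I)%:E by rewrite fineK// ge0_fin_numE// ltW.
have fI0 : 0 < fine I by rewrite -lte_fin -IE.
have -> : tilted b th setT = ((expR (- Lambda b th))%:E * I)%E.
  rewrite /I -ge0_integralZl//; last exact: measurable_funTS.
  rewrite [RHS]integral_mkcond; apply: eq_integral => x _.
  rewrite patchE /tilt_density indicE -/D; case: ifPn => xD.
    by rewrite mulr1 addrC expRD EFinM.
  by rewrite mulr0.
by rewrite IE -EFinM /Lambda /Rintegral -/I expRN lnK ?posrE// mulVf// gt_eqF.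
Qed.

Lemma mixture_setT (n : nat) (b : R) : (0 < n)%N -> mixture n b setT = 1%E.
Proof.
move=> n0; rewrite /mixture /= /mscale /= /msum.
rewrite (eq_bigr (fun=> 1%E)); last by move=> i _; exact: probability_setT.
rewrite sumEFin -EFinM big_const_ord iter_addr addr0 mulVf//.
by rewrite pnatr_eq0 -lt0n.
Qed.

Section estimators.
Variables (n : nat) (b : R).

Definition tuple_sum (x : n.-tuple R) : R := \sum_(k < n) tnth x k.

Definition tuple_max (x : n.-tuple R) : \bar R :=
  (\big[maxe/-oo]_(k < n) (tnth x k)%:E)%E.

Definition A_dom : set (n.-tuple R) :=
  [set x | b < tuple_sum x /\ (b%:E <= tuple_max x)%E].

Definition A_res : set (n.-tuple R) :=
  [set x | b < tuple_sum x /\ (tuple_max x < b%:E)%E].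

Definition Z_dom (x : n.-tuple R) : R :=
  n%:R * tail b / #|[set k : 'I_n | b <= tnth x k]%SET|%:R * \1_A_dom x.

Definition Z_res (x : n.-tuple R) : R :=
  expR (- theta n b * tuple_sum x + n%:R * Lambda b (theta n b)) * \1_A_res x.

Definition Z_total (xy : n.-tuple R * n.-tuple R) : R := Z_dom xy.1 + Z_res xy.2.

(* The samples for Z_dom and Z_res are independent, with laws P1 and P2. *)
Definition Var_Z : \bar R := ('V_(P1 n b \x P2 n b)[Z_total])%E.

End estimators.

End samplers.

(* Main.v *)
Require Import Defs.
From HB Require Import structures.
From mathcomp Require Import all_boot all_order all_algebra.
From mathcomp Require Import all_classical all_reals all_analysis.
From mathcomp Require Import measurable_realfun.
From mathcomp Require Import ring lra.

Set Implicit Arguments.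
Unset Strict Implicit.
Unset Printing Implicit Defensive.

Import Order.TTheory GRing.Theory Num.Theory.
Import numFieldNormedType.Exports.

Local Open Scope classical_set_scope.
Local Open Scope ring_scope.

(** Write c = n * tail F b and gamma = 1 / (beta + epsilon), so that
    n^(beta + epsilon) < b implies n <= b^gamma.  All estimates below hold for b
    large, uniformly over the n with n <= b^gamma.

    The variance is at most the mean square distance to any constant, so
    Var Z <= 2 E1 (Z_dom - c)^2 + 2 E2 Z_res^2 ([variance_product_sum_le]), and
    three estimates give the theorem.

    - P (S_n > b) >= const * c ([near_sum_upper_tail]): it is enough that one
      increment exceeds 2b while the others are smaller than b in absolute
      value and have a sum larger than - b, and these events are disjoint for
      distinct choices of the large increment.

    - E1 (Z_dom - c)^2 = o(c^2) ([near_dom_error]): given I = i, the estimator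
      equals c as soon as X_i > u b with u > 1, the other increments are smaller
      than b in absolute value and their sum exceeds - (u - 1) b.  By regular
      variation the first condition fails with probability close to
      1 - u^(- alpha), which is small for u close to 1.

    - E2 Z_res^2 = o(c^2) ([near_res_second_moment]): let M(phi) be the integral
      of e^(phi x) over x < b.  Since e^(- theta b) = c, tilting a little
      further, by K / b, gives
      E2 Z_res^2 <= c^2 e^(- K) M(theta)^n M(theta + K / b)^n,
      and the last two factors are bounded by e whatever K is.

    Deviations of sums are thus controlled by exponential moments only: of
    e^(- K x / b) on x > - b ([near_lower_tilt]) and of e^(phi x) on x < b
    ([near_upper_tilt]); both are at most 1 + 1 / n.  In both cases the
    truncation has the favourable sign, so that, the increments being centred,
    the first-order term of the exponential contributes nothing.  What remains
    is a multiple of n * b^(- p) * E |X|^p for some p in [1, 2], larger than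
    gamma, with a finite moment, plus, for the upper tilt, the contribution of
    the x of order b.  The moment exists with p = 2 if the variance is finite,
    since gamma < 2; otherwise the left tail is dominated by the right one and
    any p smaller than min(alpha, 2) will do ([abs_moment_finite]).  The x of
    order b are handled by cutting at t b with t < 1 close to 1: below t b by a
    moment of order q < alpha of the right tail, above t b by
    tail F (t b) / tail F b - 1, which is close to t^(- alpha) - 1.

    The only consequence of independence that is needed is that the expectation
    of a product of nonnegative functions of the coordinates factorizes
    ([factorizes]).  It holds for the given i.i.d. sequence
    ([iid_factorizes]) and for the sampling laws ([product_law_factorizes]). *)

(** * Expectations of products of independent coordinates *)

Import HBNNSimple.

(** If the image under [Y] of the measure with density [W] with respect to [mu]
    is [c] times [m], then the change of variables formula holds; by
    approximation of [g] with simple functions. *)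
Lemma weighted_integral_transfer d d' (T : measurableType d)
    (U : measurableType d') (R : realType) (mu : {measure set T -> \bar R})
    (m : {measure set U -> \bar R}) (W : T -> R) (Y : T -> U) (c : R) :
  measurable_fun setT W -> (forall t, 0 <= W t) -> measurable_fun setT Y ->
  0 <= c ->
  (forall B, measurable B ->
     \int[mu]_t (W t * \1_B (Y t))%:E = c%:E * m B)%E ->
  forall g : U -> R, measurable_fun setT g -> (forall u, 0 <= g u) ->
  (\int[mu]_t (W t * g (Y t))%:E = c%:E * \int[m]_u (g u)%:E)%E.
Proof.
move=> mW W0 mY c0 HB g mg g0.
have mEg : measurable_fun setT (EFin \o g) by exact/measurable_EFinP.
pose h := nnsfun_approx measurableT mEg.
have hg u : (h n u)%:E @[n --> \oo] --> (g u)%:E.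
  by apply: (cvg_nnsfun_approx measurableT mEg) => // x _; rewrite lee_fin.
have ndh u (a b : nat) : (a <= b)%N -> h a u <= h b u.
  by move=> ab; exact/lefP/nd_nnsfun_approx.
have mhY n : measurable_fun setT (fun t => h n (Y t)).
  have mh : measurable_fun setT (h n) by [].
  exact: (measurableT_comp mh mY).
have L : (\int[mu]_t (W t * g (Y t))%:E =
    limn (fun n => \int[mu]_t (W t * h n (Y t))%:E))%E.
  rewrite -monotone_convergence//=.
  - apply: eq_integral => t _; apply/esym/cvg_lim => //.
    rewrite EFinM; under eq_fun do rewrite EFinM.
    by apply: cvgeZl => //; exact: hg.
  - by move=> n; apply/measurable_EFinP; exact: measurable_funM.
  - by move=> n t _; rewrite lee_fin mulr_ge0.
  - by move=> t _ a b ab; rewrite lee_fin ler_wpM2l// ndh.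
have M : (\int[m]_u (g u)%:E = limn (fun n => \int[m]_u (h n u)%:E))%E.
  rewrite -monotone_convergence//=.
  - by apply: eq_integral => t _; apply/esym/cvg_lim => //; exact: hg.
  - by move=> n; apply/measurable_EFinP.
  - by move=> n t _; rewrite lee_fin.
  - by move=> t _ a b ab; rewrite lee_fin ndh.
rewrite L M -limeMl//; last first.
  apply/ereal_nondecreasing_is_cvgn => a b ab; apply: ge0_le_integral => //.
  - by move=> x _; rewrite lee_fin.
  - exact/measurable_EFinP.
  - exact/measurable_EFinP.
  - by move=> x _; rewrite lee_fin ndh.
congr (limn _); apply/funext => n.
have mI B : measurable B -> measurable_fun setT (fun t => \1_B (Y t) : R).
  by move=> mB; exact: measurableT_comp.
have h0 r u : 0 <= r * \1_(h n @^-1` [set r]) u.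
  rewrite indicE; case: (boolP (u \in _)); last by rewrite mulr0.
  by rewrite inE /= => <-; rewrite mulr1.
have mr r : measurable (h n @^-1` [set r]) by exact: measurable_sfunP.
transitivity (\int[mu]_t \sum_(r \in range (h n))
    (W t * (r * \1_(h n @^-1` [set r]) (Y t)))%:E)%E.
  apply: eq_integral => t _; rewrite {1}(fimfunE (h n)).
  by rewrite EFinM -fsumEFin// ge0_mule_fsumr// => r; rewrite lee_fin.
rewrite ge0_integral_fsum//; last 2 first.
- move=> r; apply/measurable_EFinP; apply: measurable_funM => //.
  by apply: measurable_funM => //; exact: mI.
- by move=> r t _; rewrite lee_fin mulr_ge0.
transitivity (c%:E * \int[m]_u \sum_(r \in range (h n))
    (r * \1_(h n @^-1` [set r]) u)%:E)%E; last first.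
  congr (_ * _)%E; apply: eq_integral => u _; rewrite {1}(fimfunE (h n)).
  by rewrite -fsumEFin.
rewrite ge0_integral_fsum//; last 2 first.
- by move=> r; apply/measurable_EFinP; apply: measurable_funM.
- by move=> r t _; rewrite lee_fin.
rewrite ge0_mule_fsumr//; last first.
  by move=> r; apply: integral_ge0 => u _; rewrite lee_fin.
apply: eq_fsbigr => r; rewrite inE => -[u _ hur].
have r0 : 0 <= r by rewrite -hur.
under eq_integral do rewrite mulrCA EFinM.
rewrite ge0_integralZl_EFin//; last 2 first.
- by move=> t _; rewrite lee_fin mulr_ge0.
- by apply/measurable_EFinP; apply: measurable_funM => //; exact: mI.
rewrite HB//; under [in RHS]eq_integral do rewrite EFinM.
rewrite ge0_integralZl_EFin//; last exact/measurable_EFinP.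
by rewrite integral_indic// setIT muleCA.
Qed.

Section product_formula.
Context {d : measure_display} {T : measurableType d} {R : realType}.

(** The coordinates [Y k] behave under [P] like independent variables with laws
    [mu k], as far as expectations of products are concerned.  Restricting the
    test functions to values in [0, 1] keeps all the integrals finite; see
    [factorizes_bounded] for bounded nonnegative ones. *)
Definition factorizes (P : probability T R) (n : nat)
    (Y : 'I_n -> T -> R) (mu : 'I_n -> probability R R) : Prop :=
  (forall k, measurable_fun setT (Y k)) /\
  forall g : 'I_n -> R -> R,
    (forall k, measurable_fun setT (g k)) ->
    (forall k x, 0 <= g k x <= 1) ->
  (\int[P]_w (\prod_(k < n) g k (Y k w))%:E =
   \prod_(k < n) \int[mu k]_x (g k x)%:E)%E.

End product_formula.

Lemma integral_bounded_fin_num d (T : measurableType d) (R : realType)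
    (P : probability T R) (f : T -> R) :
  measurable_fun setT f -> (forall x, 0 <= f x <= 1) ->
  (\int[P]_x (f x)%:E \is a fin_num)%E.
Proof.
move=> mf f01; rewrite ge0_fin_numE; last first.
  by apply: integral_ge0 => x _; rewrite lee_fin; case/andP: (f01 x).
apply: (@le_lt_trans _ _ (\int[P]_x (cst 1%:E x))%E).
  apply: ge0_le_integral => //.
  - by move=> x _; rewrite lee_fin; case/andP: (f01 x).
  - exact/measurable_EFinP.
  - by move=> x _; rewrite lee_fin; case/andP: (f01 x).
by rewrite integral_cst// mul1e (le_lt_trans (probability_le1 P measurableT))// ltry.
Qed.

Section iid_factorizes.
Context {d : measure_display} {T : measurableType d} {R : realType}.
Variables (P : probability T R) (X : nat -> {RV P >-> R}).
Hypothesis X_indep : mutually_independent X.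

(** Independence of events is extended to functions one coordinate at a time:
    the coordinates in [s1] carry functions, those in [s2] still carry sets. *)
Lemma indep_prod (g : nat -> R -> R) (s1 s2 : seq nat) (A : nat -> set R) :
  (forall k, measurable_fun setT (g k)) -> (forall k x, 0 <= g k x <= 1) ->
  (forall k, measurable (A k)) -> uniq (s1 ++ s2) ->
  (\int[P]_w (\prod_(k <- s1) g k (X k w) * \prod_(k <- s2) \1_(A k) (X k w))%:E
   = \prod_(k <- s1) \int[distribution P (X k)]_x (g k x)%:E *
     \prod_(k <- s2) P (X k @^-1` A k))%E.
Proof.
move=> mg g01; have mX k : measurable_fun setT (X k) by [].
have mXA k B : measurable B -> measurable (X k @^-1` B).
  by move=> mB; rewrite -[_ @^-1` _]setTI; exact: mX.
elim: s1 s2 A => [|k s1 IH] s2 A mA.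
  rewrite /= => us2; rewrite [in RHS]big_nil mul1e -X_indep//.
  set B := \big[_/_]_(_ <- _) _.
  have mB : measurable B.
    by rewrite /B; elim/big_ind: _ => //; [exact: measurableI|move=> k _; exact: mXA].
  rewrite -(setIT B) -(integral_indic P measurableT)// /B {B mB}.
  apply: eq_integral => w _; congr EFin; rewrite big_nil mul1r.
  elim: s2 {us2} => [|k s2 IH2]; first by rewrite !big_nil indicT.
  by rewrite !big_cons IH2 indicI.
move=> /= /andP[]; rewrite mem_cat negb_or => /andP[ks1 ks2] u12.
have fin j : (\int[distribution P (X j)]_x (g j x)%:E \is a fin_num)%E.
  exact: integral_bounded_fin_num.
have finA j B : measurable B -> P (X j @^-1` B) \is a fin_num.
  by move=> mB; apply: fin_num_measure; exact: mXA.
set p1 := (\prod_(j <- s1) \int[distribution P (X j)]_x (g j x)%:E)%E.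
set p2 := (\prod_(j <- s2) P (X j @^-1` A j))%E.
have p1f : p1 \is a fin_num by apply: prode_fin_num => j _.
have p2f : p2 \is a fin_num by apply: prode_fin_num => j _; exact: finA.
have p10 : (0 <= p1)%E.
  apply: prode_ge0 => j _; apply: integral_ge0 => x _.
  by rewrite lee_fin; case/andP: (g01 j x).
have p20 : (0 <= p2)%E by apply: prode_ge0 => j _.
pose c := fine (p1 * p2)%E.
have cE : (c%:E = p1 * p2)%E by rewrite fineK// fin_numM.
transitivity (\int[P]_w ((\prod_(j <- s1) g j (X j w) *
   \prod_(j <- s2) \1_(A j) (X j w)) * g k (X k w))%:E)%E.
  by apply: eq_integral => w _; congr EFin; rewrite big_cons; ring.
rewrite (@weighted_integral_transfer _ _ _ _ _ P (distribution P (X k)) _ (X k) c)//.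
- by rewrite cE big_cons -/p1 muleC muleA.
- apply: measurable_funM; apply: measurable_prod => j _.
    exact: measurableT_comp.
  by apply: measurableT_comp => //; exact: measurable_indic.
- move=> w; rewrite mulr_ge0// prodr_ge0// => j _.
  by case/andP: (g01 j (X j w)).
- by rewrite /c fine_ge0// mule_ge0.
(* For an indicator, the coordinate k moves from the functions to the sets. *)
- move=> B mB; pose A' j := if j == k then B else A j.
  have mA' j : measurable (A' j) by rewrite /A'; case: ifP.
  have := IH (k :: s2) A' mA'.
  rewrite -cat1s uniq_catCA /= mem_cat negb_or ks1 ks2 u12 => /(_ isT).
  have A'k : A' k = B by rewrite /A' eqxx.
  rewrite -/p1 [X in (_ = _ * X)%E -> _]big_cons A'k.
  have -> : (\prod_(j <- s2) P (X j @^-1` A' j))%E = p2.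
    apply: eq_big_seq => j js2; rewrite /A'; case: eqP => // jk.
    by rewrite -jk js2 in ks2.
  rewrite [X in _ = X -> _]muleCA -cE muleC => <-.
  apply: eq_integral => w _; congr EFin; rewrite -mulrA; congr (_ * _).
  rewrite big_cons A'k mulrC; congr (_ * _).
  apply: eq_big_seq => j js2; rewrite /A'; case: eqP => // jk.
  by rewrite -jk js2 in ks2.
- by move=> x; case/andP: (g01 k x).
Qed.

Lemma iid_factorizes n : identically_distributed X ->
  factorizes P (fun k : 'I_n => (X k : T -> R))
    (fun=> distribution P (X 0%N)).
Proof.
move=> Xid; split=> [k|g mg g01]; first by [].
pose g' (k : nat) : R -> R := if insub k is Some i then g i else cst 0.
have mg' k : measurable_fun setT (g' k) by rewrite /g'; case: insubP.
have g'01 k x : 0 <= g' k x <= 1.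
  by rewrite /g'; case: insubP => //=; rewrite lexx ler01.
have := @indep_prod g' (index_iota 0 n) [::] (fun=> setT) mg' g'01 (fun=> measurableT).
rewrite cats0 iota_uniq => /(_ isT); rewrite [in RHS]big_nil mule1 big_mkord => gE.
transitivity (\int[P]_w (\prod_(0 <= k < n) g' k (X k w) *
  \prod_(k <- [::]) \1_(setT : set R) (X k w))%:E)%E.
  apply: eq_integral => w _; congr EFin; rewrite big_nil mulr1 big_mkord.
  by apply: eq_bigr => k _; rewrite /g' valK.
rewrite gE; apply: eq_bigr => k _.
rewrite /g' valK; apply: eq_measure_integral => B mB _; exact: Xid.
Qed.

End iid_factorizes.

Section product_law.
Context {d : measure_display} {U : measurableType d} {R : realType}.

Lemma measurable_prod_tnth n (g : 'I_n -> U -> R) :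
  (forall k, measurable_fun setT (g k)) ->
  measurable_fun setT (fun x : n.-tuple U => \prod_(k < n) g k (tnth x k)).
Proof.
move=> mg; apply: measurable_prod => k _.
by apply: (measurableT_comp (mg k)); exact: measurable_tnth.
Qed.

(** Tonelli for [product_law], one coordinate at a time. *)
Lemma integral_product_law n (mu : nat -> probability U R) (g : nat -> U -> R) :
  (forall k, measurable_fun setT (g k)) -> (forall k x, 0 <= g k x) ->
  (\int[product_law n mu]_x (\prod_(k < n) g k (tnth x k))%:E =
   \prod_(k < n) \int[mu k]_x (g k x)%:E)%E.
Proof.
elim: n mu g => [|n IH] mu g mg g0.
  rewrite big_ord0 /=; under eq_integral do rewrite big_ord0.
  by rewrite integral_dirac// diracT mul1e.
pose f := fun x : n.+1.-tuple U => (\prod_(k < n.+1) g k (tnth x k))%:E.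
have mf : measurable_fun setT f.
  by apply/measurable_EFinP; exact: (@measurable_prod_tnth _ (fun k : 'I__ => g k)).
have f0 x : (0 <= f x)%E by rewrite lee_fin prodr_ge0.
rewrite [LHS](@ge0_integral_distribution _ _ _ _ _
  (mu 0%N \x product_law n (fun k => mu k.+1))%E tcons f mf f0).
have fE z : (f \o tcons) z =
    ((g 0%N z.1)%:E * (\prod_(k < n) g k.+1 (tnth z.2 k))%:E)%E.
  rewrite /f /= big_ord_recl EFinM; congr (_ * _%:E)%E.
  by apply: eq_bigr => k _; rewrite tnthS.
rewrite fubini_tonelli1; last 2 first.
  exact: (measurableT_comp mf (@measurable_tcons _ _ n)).
  by move=> z; exact: f0.
rewrite big_ord_recl /fubini_F.
under eq_integral do under eq_integral do rewrite fE /=.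
under eq_integral => z _.
  rewrite ge0_integralZl_EFin//; last 2 first.
  - by move=> x _; rewrite lee_fin prodr_ge0.
  - apply/measurable_EFinP.
    exact: (@measurable_prod_tnth _ (fun k : 'I__ => g k.+1)).
  rewrite (IH (fun k => mu k.+1) (fun k => g k.+1))//.
  over.
rewrite ge0_integralZr//.
- exact/measurable_EFinP.
- by move=> x _; rewrite lee_fin.
- by apply: prode_ge0 => k _; apply: integral_ge0 => x _; rewrite lee_fin.
Qed.

End product_law.

Lemma product_law_factorizes (R : realType) n (mu : nat -> probability R R) :
  factorizes (product_law n mu) (fun k x => tnth x k) (fun k => mu k).
Proof.
split=> [k|g mg g01]; first exact: measurable_tnth.
pose g' (k : nat) : R -> R := if insub k is Some i then g i else cst 0.
have mg' k : measurable_fun setT (g' k) by rewrite /g'; case: insubP.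
have g'0 k x : 0 <= g' k x.
  by rewrite /g'; case: insubP => //= i _ _; case/andP: (g01 i x).
have g'E (k : 'I_n) : g' k = g k by rewrite /g' valK.
under eq_integral do under eq_bigr do rewrite -g'E.
by rewrite integral_product_law//; apply: eq_bigr => k _; rewrite g'E.
Qed.

Lemma measure_le_integral d (T : measurableType d) (R : realType)
    (P : {measure set T -> \bar R}) (E : set T) (f : T -> R) :
  measurable E -> measurable_fun setT f -> (forall w, 0 <= f w) ->
  (forall w, E w -> 1 <= f w) -> (P E <= \int[P]_w (f w)%:E)%E.
Proof.
move=> mE mf f0 f1; rewrite -[E]setIT -integral_indic//.
apply: ge0_le_integral => //.
- by apply/measurable_EFinP; exact: measurable_indic.
- exact/measurable_EFinP.
- move=> w _; rewrite lee_fin indicE; case: (boolP (w \in E)) => [|_]//.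
  by rewrite inE => /f1.
Qed.

Lemma measurable_norm_ge (R : realType) (b : R) :
  measurable [set x : R | b <= `|x|].
Proof.
rewrite (_ : mkset _ = setT `&` (fun x : R => `|x|) @^-1` `[b, +oo[%classic).
  by apply: normr_measurable => //; exact: measurable_itv.
by apply/seteqP; split=> x /=; rewrite in_itv/= andbT => // -[].
Qed.

Lemma integral_one d (T : measurableType d) (R : realType)
  (P : probability T R) : (\int[P]_x 1%:E = 1)%E.
Proof. by rewrite -[RHS](probability_setT P) integral_cst// mul1e. Qed.

Section factorizes.
Context {d : measure_display} {T : measurableType d} {R : realType}.
Variables (P : probability T R) (n : nat).
Variables (Y : 'I_n -> T -> R) (mu : 'I_n -> probability R R).
Hypothesis fac : factorizes P Y mu.

Lemma factorizes_bounded (M : R) (g : 'I_n -> R -> R) : 0 < M ->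
  (forall k, measurable_fun setT (g k)) -> (forall k x, 0 <= g k x <= M) ->
  (\int[P]_w (\prod_(k < n) g k (Y k w))%:E =
   \prod_(k < n) \int[mu k]_x (g k x)%:E)%E.
Proof.
move=> M0 mg gM; have [mY fac1] := fac.
have := fac1 (fun k x => M^-1 * g k x).
have mg' k : measurable_fun setT (fun x => M^-1 * g k x).
  by apply: measurable_funM.
have g'1 k x : 0 <= M^-1 * g k x <= 1.
  have /andP[g0 g1] := gM k x.
  by rewrite mulr_ge0 ?invr_ge0 ?(ltW M0)//= mulrC ler_pdivrMr// mul1r.
move=> /(_ mg' g'1) H.
have M1 : M^-1 != 0 by rewrite invr_eq0 gt_eqF.
have g0 k x : 0 <= g k x by case/andP: (gM k x).
have mp : measurable_fun setT (fun w => \prod_(k < n) g k (Y k w)).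
  by apply: measurable_prod => k _; apply: measurableT_comp.
have : (((M^-1) ^+ n)%:E * \int[P]_w (\prod_(k < n) g k (Y k w))%:E =
       ((M^-1) ^+ n)%:E * \prod_(k < n) \int[mu k]_x (g k x)%:E)%E.
  rewrite -ge0_integralZl_EFin//; last 3 first.
  - by move=> w _; rewrite lee_fin prodr_ge0.
  - exact/measurable_EFinP.
  - by rewrite exprn_ge0// invr_ge0 ltW.
  transitivity (\int[P]_w (\prod_(k < n) (M^-1 * g k (Y k w)))%:E)%E.
    by apply: eq_integral => w _; rewrite big_split/= prodr_const card_ord EFinM.
  have -> : ((M^-1 ^+ n)%:E = \prod_(k < n) (M^-1)%:E)%E.
    by rewrite prodEFin prodr_const card_ord.
  rewrite H -big_split/=.
  apply: eq_bigr => k _; under eq_integral do rewrite EFinM.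
  rewrite ge0_integralZl_EFin//.
  - by move=> w _; rewrite lee_fin.
  - exact/measurable_EFinP.
  - by rewrite invr_ge0 ltW.
move=> /(congr1 (fun x => ((M ^+ n)%:E * x)%E)).
by rewrite !muleA -!EFinM -exprMn mulfV ?gt_eqF// expr1n !mul1e.
Qed.

Lemma factorizes_one (i : 'I_n) (A : set R) (M : R) (g : R -> R) : 0 < M ->
  measurable A -> measurable_fun setT g -> (forall x, 0 <= g x <= M) ->
  (\int[P]_w (\1_A (Y i w) * \prod_(j < n | j != i) g (Y j w))%:E =
   mu i A * \prod_(j < n | j != i) \int[mu j]_x (g x)%:E)%E.
Proof.
move=> M0 mA mg gM.
pose G k x := if k == i then \1_A x else g x.
transitivity (\int[P]_w (\prod_(k < n) G k (Y k w))%:E)%E.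
  apply: eq_integral => w _; rewrite [in RHS](bigD1 i)//= /G eqxx.
  by congr (_ * _)%:E; apply: eq_bigr => j /negbTE ->.
rewrite (@factorizes_bounded (Num.max 1 M)).
- rewrite (bigD1 i)//= /G eqxx; congr (_ * _)%E.
    by rewrite integral_indic// setIT.
  by apply: eq_bigr => j /negbTE ->.
- by rewrite lt_max ltr01.
- by move=> k; rewrite /G; case: (k == i) => //; exact: measurable_indic.
- move=> k x; rewrite /G le_max; case: ifP => _.
    by rewrite indicE lern1 leq_b1 ler0n.
  by case/andP: (gM x) => -> ->; rewrite orbT.
Qed.

Lemma factorizes_preimage (i : 'I_n) (A : set R) : measurable A ->
  measurable (Y i @^-1` A).
Proof.
by move=> mA; rewrite -[_ @^-1` _]setTI; have [mY _] := fac; exact: mY.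
Qed.

Lemma factorizes_marginal (i : 'I_n) (A : set R) : measurable A ->
  P (Y i @^-1` A) = mu i A.
Proof.
move=> mA.
have c1 (x : R) : 0 <= (cst 1 x : R) <= 1 by rewrite /= ler01 lexx.
have := @factorizes_one i A 1 (cst 1) ltr01 mA (measurable_cst _) c1.
under eq_integral do rewrite big1_eq mulr1.
under eq_bigr do rewrite /= integral_one.
rewrite big1_eq mule1 => <-.
by rewrite -[X in P X]setIT -integral_indic//; exact: factorizes_preimage.
Qed.

Lemma factorizes_pair (i j : 'I_n) (A B : set R) : i != j ->
  measurable A -> measurable B ->
  P (Y i @^-1` A `&` Y j @^-1` B) = (mu i A * mu j B)%E.
Proof.
move=> ij mA mB.
pose G k x : R := if k == i then \1_A x else if k == j then \1_B x else 1.
rewrite -[X in P X]setIT -integral_indic//; last first.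
  by apply: measurableI; exact: factorizes_preimage.
transitivity (\int[P]_w (\prod_(k < n) G k (Y k w))%:E)%E.
  apply: eq_integral => w _; rewrite [in RHS](bigD1 i)//= (bigD1 j) 1?eq_sym//=.
  rewrite /G eqxx [j == i]eq_sym (negbTE ij) eqxx big1 => [|k]; last first.
    by move=> /andP[/negbTE -> /negbTE ->].
  by rewrite mulr1 indicI.
rewrite (@factorizes_bounded 1)//.
- rewrite (bigD1 i)//= (bigD1 j) 1?eq_sym//= /G eqxx [j == i]eq_sym (negbTE ij) eqxx.
  rewrite big1 => [|k /andP[/negbTE -> /negbTE ->]]; last first.
    by rewrite integral_one.
  by rewrite mule1 !integral_indic// !setIT.
- move=> k; rewrite /G; case: (k == i); [|case: (k == j)] => //;
    exact: measurable_indic.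
- move=> k x; rewrite /G; case: ifP => _; [|case: ifP => _].
  + by rewrite indicE lern1 leq_b1 ler0n.
  + by rewrite indicE lern1 leq_b1 ler0n.
  + by rewrite lexx ler01.
Qed.

Lemma measurable_sum_others (i : 'I_n) :
  measurable_fun setT (fun w => \sum_(j < n | j != i) Y j w).
Proof.
have [mY _] := fac.
under eq_fun do rewrite big_mkcond/=.
by apply: measurable_sum => j; case: (j != i).
Qed.

(** Chernoff bound for the coordinates other than [i], jointly with an event
    on the coordinate [i]: either some [|Y j|] is at least [b], or the sum of
    the others is at most [- s * b] while all of them exceed [- b], which is
    where the truncated exponential moment [D] enters. *)
Lemma sum_others_lower_tail (i : 'I_n) (A : set R) (E : set T)
    (a b s K D : R) :
  measurable A -> measurable E ->
  (forall w, E w -> A (Y i w) /\ (\sum_(j < n | j != i) Y j w <= - (s * b) \/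
    exists2 j, j != i & b <= `|Y j w|)) ->
  0 < b -> 0 <= K -> 1 <= D -> 0 <= a ->
  (forall j, j != i -> mu j [set x | (b <= `|x|)%R] <= a%:E)%E ->
  (forall j, j != i ->
    \int[mu j]_x (\1_(`](- b)%R, +oo[%classic) x * expR (- (K / b) * x))%:E
      <= D%:E)%E ->
  (P E <= mu i A * (n%:R * a + expR (- (K * s)) * D ^+ n)%:E)%E.
Proof.
move=> mA mE EA b0 K0 D1 a0 Ha HD.
have [mY _] := fac.
set L := [set x : R | b <= `|x|]; set U := `](- b), +oo[%classic.
have mL : measurable L by exact: measurable_norm_ge.
have mU : measurable U by exact: measurable_itv.
pose h x : R := \1_U x * expR (- (K / b) * x).
have mh : measurable_fun setT h.
  apply: measurable_funM; first exact: measurable_indic.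
  apply: measurableT_comp; first exact: measurable_expR.
  exact: mulrl_measurable.
have hK x : 0 <= h x <= expR K.
  rewrite /h indicE mulr_ge0 ?expR_ge0//=; case: (boolP (x \in U)) => [|_].
    rewrite inE /U/= in_itv/= andbT mul1r ler_expR => xb.
    rewrite mulNr -mulrN -[leRHS](@divfK _ b) ?gt_eqF//.
    by rewrite ler_wpM2l ?divr_ge0 ?(ltW b0)//; lra.
  by rewrite mul0r expR_ge0.
have iA0 w : 0 <= \1_A (Y i w) :> R by [].
(* f dominates the indicator of E: a union bound for the large coordinates, an
   exponential bound for the sum. *)
pose f w : R := \sum_(j < n | j != i) (\1_A (Y i w) * \1_L (Y j w)) +
  expR (- (K * s)) * (\1_A (Y i w) * \prod_(j < n | j != i) h (Y j w)).
have mIA B j : measurable B -> measurable_fun setT (fun w => \1_B (Y j w) : R).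
  by move=> mB; apply: measurableT_comp => //; exact: measurable_indic.
have mf1 j : measurable_fun setT (fun w => \1_A (Y i w) * \1_L (Y j w) : R).
  by apply: measurable_funM; exact: mIA.
have mfs : measurable_fun setT
    (fun w => \sum_(j < n | j != i) (\1_A (Y i w) * \1_L (Y j w) : R)).
  under eq_fun do rewrite big_mkcond/=.
  by apply: measurable_sum => j; case: (j != i).
have mfp : measurable_fun setT
    (fun w => \1_A (Y i w) * \prod_(j < n | j != i) h (Y j w) : R).
  apply: measurable_funM; first exact: mIA.
  under eq_fun do rewrite big_mkcond/=.
  by apply: measurable_prod => j _; case: (j != i) => //; exact: measurableT_comp.
have h0 x : 0 <= h x by case/andP: (hK x).
have fs0 w : 0 <= \sum_(j < n | j != i) (\1_A (Y i w) * \1_L (Y j w) : R).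
  by apply: sumr_ge0 => j _; rewrite mulr_ge0.
have fp0 w : 0 <= \1_A (Y i w) * \prod_(j < n | j != i) h (Y j w) :> R.
  by rewrite mulr_ge0// prodr_ge0.
have mf : measurable_fun setT f.
  by apply: measurable_funD => //; exact: measurable_funM.
apply: (@le_trans _ _ (\int[P]_w (f w)%:E)%E).
  apply: measure_le_integral => //.
  - by move=> w; rewrite addr_ge0// mulr_ge0// expR_ge0.
  - move=> w /EA[Aw ES]; rewrite /f indicE mem_set// /=.
    have [[j ji Lj]|nL] := pselect (exists2 j, j != i & L (Y j w)).
      rewrite (bigD1 j)//= indicE mem_set// mulr1 -addrA lerDl addr_ge0//.
        by apply: sumr_ge0 => k _; rewrite mulr_ge0.
      by rewrite mul1r mulr_ge0 ?expR_ge0// prodr_ge0.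
    have Sw : \sum_(j < n | j != i) Y j w <= - (s * b) by case: ES.
    rewrite mul1r [leRHS]addrC ler_wpDr//.
      by apply: sumr_ge0 => k _; rewrite mulr_ge0.
    rewrite (eq_bigr (fun j => expR (- (K / b) * Y j w))) => [|j ji]; last first.
      rewrite /h indicE mem_set ?mul1r// /U /= in_itv/= andbT ltNge.
      apply/negP => H; apply: nL; exists j => //; rewrite /L/=.
      by rewrite ler0_norm; lra.
    rewrite -expR_sum -expRD -mulr_sumr -expR0 ler_expR.
    have : (K / b) * (\sum_(j < n | j != i) Y j w) <= (K / b) * (- (s * b)).
      by rewrite ler_wpM2l// divr_ge0// ltW.
    rewrite mulrN [_ * (s * b)]mulrA [_ / b * s * b]mulrAC divfK ?gt_eqF//.
    by move=> H; rewrite mulNr; lra.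
under eq_integral do rewrite EFinD.
rewrite ge0_integralD//; last 4 first.
- by move=> w _; rewrite lee_fin.
- exact/measurable_EFinP.
- by move=> w _; rewrite lee_fin mulr_ge0// expR_ge0.
- by apply/measurable_EFinP; exact: measurable_funM.
have D0 : 0 <= D by lra.
rewrite EFinD ge0_muleDr ?lee_fin ?mulr_ge0 ?exprn_ge0 ?expR_ge0//.
apply: leeD.
- under eq_integral do rewrite -sumEFin -big_filter.
  rewrite ge0_integral_sum//; last by move=> j; apply/measurable_EFinP.
  apply: (@le_trans _ _ (\sum_(j < n | j != i) (mu i A * a%:E))%E).
    rewrite big_filter; apply: lee_sum => j ji.
    rewrite (_ : integral _ _ _ =
      \int[P]_w (\1_(Y i @^-1` A `&` Y j @^-1` L) w)%:E)%E; last first.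
      by apply: eq_integral => w _; rewrite indicI.
    rewrite integral_indic//; last first.
      by apply: measurableI; exact: factorizes_preimage.
    have ij : i != j by rewrite eq_sym.
    rewrite setIT [leLHS](factorizes_pair ij mA mL).
    by rewrite lee_wpmul2l// Ha.
  have muA : mu i A \is a fin_num by exact: fin_num_measure.
  rewrite -(fineK muA) -EFinM sumEFin lee_fin mulrCA.
  rewrite mulr_natl -[X in _ *+ X](card_ord n) -sumr_const big_mkcond/=.
  apply: ler_sum => j _; case: (j != i) => //.
  by rewrite mulr_ge0// fine_ge0.
- under eq_integral do rewrite EFinM.
  rewrite ge0_integralZl_EFin ?expR_ge0//; last 2 first.
  + by move=> w _; rewrite lee_fin.
  + exact/measurable_EFinP.
  rewrite (@factorizes_one _ _ (expR K)) ?expR_gt0//.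
  rewrite EFinM muleCA lee_wpmul2l ?lee_fin ?expR_ge0//.
  rewrite lee_wpmul2l//.
  have hf j : (\int[mu j]_x (h x)%:E)%E \is a fin_num.
    rewrite ge0_fin_numE; last first.
      by apply: integral_ge0 => x _; rewrite lee_fin.
    have [->|ji] := eqVneq j i; last exact: le_lt_trans (HD _ ji) (ltry _).
    apply: (@le_lt_trans _ _ (\int[mu i]_x (cst (expR K)%:E x))%E).
      apply: ge0_le_integral => //.
      - by move=> x _; rewrite lee_fin.
      - exact/measurable_EFinP.
      - by move=> x _; rewrite lee_fin; case/andP: (hK x).
    by rewrite integral_cst//; apply: lte_mul_pinfty;
      rewrite ?lee_fin ?expR_ge0// (le_lt_trans (probability_le1 _ _)) ?ltry.
  under eq_bigr do rewrite -(fineK (hf _)).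
  rewrite prodEFin lee_fin -[X in _ <= _ ^+ X](card_ord n) -prodr_const big_mkcond/=.
  apply: ler_prod => j _; case: ifP => [ji|_]; last by rewrite ler01.
  rewrite fine_ge0 ?integral_ge0// => [|x _]; last by rewrite lee_fin.
  by rewrite -lee_fin fineK// HD.
Qed.

(** One coordinate exceeds [2 * b], the others are smaller than [b] in absolute
    value and their sum exceeds [- b]: this forces a sum larger than [b], and
    the events obtained for distinct large coordinates are disjoint. *)
Lemma sum_upper_tail_ge (t b a K D : R) :
  (forall i, mu i `]2 * b, +oo[%classic = t%:E) ->
  0 < b -> 0 <= K -> 1 <= D -> 0 <= a ->
  (forall j, mu j [set x | (b <= `|x|)%R] <= a%:E)%E ->
  (forall j,
    \int[mu j]_x (\1_(`](- b)%R, +oo[%classic) x * expR (- (K / b) * x))%:E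
      <= D%:E)%E ->
  ((n%:R * (t * (1 - (n%:R * a + expR (- K) * D ^+ n))))%:E <=
    P [set w | (b < \sum_(j < n) Y j w)%R])%E.
Proof.
move=> tE b0 K0 D1 a0 Ha HD; have [mY _] := fac.
pose B := `]2 * b, +oo[%classic.
pose E i := Y i @^-1` B `&` [set w | (forall j, j != i -> `|Y j w| < b) /\
                               - b < \sum_(j < n | j != i) Y j w].
have mB : measurable B by exact: measurable_itv.
have mE i : measurable (E i).
  apply: measurableI; first exact: factorizes_preimage.
  rewrite (_ : mkset _ =
      (\bigcap_(j in [set j | j != i]) (Y j @^-1` (~` [set x | b <= `|x|])))
    `&` ((fun w => \sum_(j < n | j != i) Y j w) @^-1` `](- b), +oo[)).
    apply: measurableI.
      apply: fin_bigcap_measurable; first exact: finite_finset.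
      move=> j _; apply: factorizes_preimage; apply: measurableC.
      exact: measurable_norm_ge.
    rewrite -[X in measurable X]setTI.
    by apply: measurable_sum_others => //; exact: measurable_itv.
  apply/seteqP; split=> w /= -[H1 H2]; split.
  - by move=> j ji; apply/negP; rewrite -ltNge; exact: H1.
  - by rewrite in_itv/= andbT.
  - by move=> j ji; have /negP := H1 j ji; rewrite -ltNge.
  - by move: H2; rewrite in_itv/= andbT.
have tot : trivIset setT E.
  move=> i j _ _ [w [[/= Bi _] [_ [/= Hj _]]]].
  apply/eqP; apply/negP => /negP /Hj; move: Bi.
  rewrite /B /= in_itv/= andbT => Bi /(le_lt_trans (ler_norm _)); lra.
have D0 : 0 <= D by lra.
have EP i : ((t * (1 - (n%:R * a + expR (- K) * D ^+ n)))%:E <= P (E i))%E.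
  have mBi := factorizes_preimage i mB.
  have mBE : measurable (Y i @^-1` B `\` E i) by exact: measurableD.
  have : (P (Y i @^-1` B `\` E i) <=
     mu i B * (n%:R * a + expR (- (K * 1)) * D ^+ n)%:E)%E.
    apply: (@sum_others_lower_tail i B _ a b 1 K D) => //.
    move=> w [Bw Ew]; split => //; rewrite mul1r.
    have [|nV] := pselect (exists2 j, j != i & b <= `|Y j w|); first by right.
    left; rewrite leNgt; apply/negP => H; apply: Ew; split => //; split => //.
    by move=> j ji; rewrite ltNge; apply/negP => H'; apply: nV; exists j.
  have : P (Y i @^-1` B) = (P (Y i @^-1` B `\` E i) + P (E i))%E.
    rewrite (measureDI P mBi (mE i)); congr (_ + P _)%E.
    by apply/setIidPr => w [].
  rewrite (factorizes_marginal i mB) tE mulr1.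
  rewrite -(fineK (fin_num_measure P _ mBE)) -(fineK (fin_num_measure P _ (mE i))).
  rewrite -EFinM -EFinD !lee_fin => -[]; lra.
apply: (@le_trans _ _ (\sum_(i < n) P (E i))%E).
  rewrite mulr_natl -[X in _ *+ X](card_ord n) -sumr_const -sumEFin.
  exact: lee_sum.
rewrite -measure_semi_additive_ord//; last exact: bigsetU_measurable.
apply: le_measure; rewrite ?inE.
- exact: bigsetU_measurable.
- rewrite -[X in measurable X]setTI (_ : mkset _ = (fun w => \sum_(j < n) Y j w) @^-1` `]b, +oo[).
    by apply: measurable_sum => //; exact: measurable_itv.
  by apply/seteqP; split=> w /=; rewrite in_itv/= andbT.
elim/big_ind : _ => [//|A1 A2 H1 H2 w [/H1|/H2]//|i _ w [/= Bi [_ H]]].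
rewrite (bigD1 i)//=; move: Bi; rewrite /B /= in_itv/= andbT => Bi.
lra.
Qed.

End factorizes.

(** * Exponential moments of truncated centred variables *)

Lemma expR_le_taylor2 (R : realType) (u : R) : u <= 1 ->
  expR u <= 1 + u + 2 * u ^+ 2.
Proof.
move=> u1; have [u0|u0] := leP u 0.
  have : expR (- u) >= 1 - u by have := expR_ge1Dx (- u); lra.
  rewrite expRN => H; have e0 := expR_gt0 u.
  have : expR u * (1 - u) <= 1.
    by rewrite -[leRHS](@mulfV _ (expR u)) ?gt_eqF// ler_wpM2l// ltW.
  nra.
(* For 0 < u <= 1, use e^u = (e^(u/2))^2 <= (1 - u/2)^(-2). *)
have : expR (- (u / 2)) >= 1 - u / 2 by have := expR_ge1Dx (- (u / 2)); lra.
rewrite expRN => H; have e0 := expR_gt0 (u / 2).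
have H1 : expR (u / 2) * (1 - u / 2) <= 1.
  by rewrite -[leRHS](@mulfV _ (expR (u / 2))) ?gt_eqF// ler_wpM2l// ltW.
have -> : expR u = expR (u / 2) ^+ 2.
  by rewrite expr2 -expRD; congr expR; lra.
set e := expR (u / 2) in e0 H1 *.
have : e ^+ 2 * (1 - u / 2) ^+ 2 <= 1.
  by rewrite -exprMn expr_le1// mulr_ge0 ?(ltW e0)//; lra.
have : 1 <= (1 - u / 2) ^+ 2 * (1 + u + 2 * u ^+ 2).
  have : 0 <= u ^+ 2 * ((1 - u) * (5 / 4 - u / 2)).
    by rewrite mulr_ge0 ?sqr_ge0// mulr_ge0//; lra.
  lra.
have : 0 < (1 - u / 2) ^+ 2 by rewrite exprn_gt0//; lra.
set z := (1 - u / 2) ^+ 2; set v := 1 + u + 2 * u ^+ 2 => z0 A B.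
rewrite -(ler_pM2r z0); apply: (le_trans B); rewrite mulrC; lra.
Qed.

(** Second-order expansion with remainder of order [p] between 1 and 2: the
    remainder only asks for a moment of order [p]. *)
Lemma expR_le_taylor (R : realType) (p q u : R) : 1 <= p -> p <= 2 -> 1 <= q ->
  u <= q -> expR u <= 1 + u + expR q * `|u| `^ p.
Proof.
move=> p1 p2 q1 uq.
have q2 : 2 <= expR q by have := expR_ge1Dx q; lra.
have pu : 0 <= `|u| `^ p by exact: powR_ge0.
have [u1|u1] := leP `|u| 1.
  have : u <= 1 by exact: le_trans (ler_norm u) u1.
  move=> /expR_le_taylor2 /le_trans; apply; rewrite lerD2l.
  rewrite ler_pM ?sqr_ge0// -real_normK ?num_real//.
  have [->|u0] := eqVneq u 0; first by rewrite normr0 expr0n/= powR_ge0.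
  by rewrite -powR_mulrn// ger_powR// normr_gt0 u0 u1.
have pu1 : `|u| <= `|u| `^ p.
  by rewrite -[leLHS]powRr1// ler_powR// ltW.
have [u0|u0] := ltP u 0.
  have e1 : expR u <= 1 by rewrite -expR0 ler_expR ltW.
  apply: (le_trans e1).
  have : 2 * `|u| <= expR q * `|u| `^ p by rewrite ler_pM.
  by rewrite (ltr0_norm u0); lra.
have : expR u <= expR q * `|u| `^ p.
  rewrite -[leLHS]mulr1 ler_pM ?expR_ge0// ?ler_expR//.
  exact: le_trans (ltW u1) pu1.
lra.
Qed.

(** The function [x |-> expR (phi * x) / x `^ q] is nondecreasing where
    [q <= phi * x]. *)
Lemma expR_le_power (R : realType) (q phi x y : R) : 0 <= q -> 0 < x -> x <= y ->
  q <= phi * x -> expR (phi * x) <= (x / y) `^ q * expR (phi * y).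
Proof.
move=> q0 x0 xy qx; have y0 : 0 < y by exact: lt_le_trans xy.
rewrite -[(x / y) `^ q]lnK ?posrE ?powR_gt0 ?divr_gt0// -expRD ler_expR.
rewrite ln_powR ln_div ?posrE//.
have : ln (y / x) <= y / x - 1.
  have := @le_ln1Dx R (y / x - 1); rewrite [1 + _]addrC subrK; apply.
  by have : 0 < y / x by [exact: divr_gt0]; lra.
rewrite ln_div ?posrE// => H.
have h0 : 0 <= y / x - 1 by rewrite subr_ge0 ler_pdivlMr// mul1r.
have : q * (y / x - 1) <= phi * x * (y / x - 1) by rewrite ler_wpM2r.
rewrite [phi * x * _](_ : _ = phi * (y - x)); last by field; rewrite gt_eqF.
have : q * (ln y - ln x) <= q * (y / x - 1) by rewrite ler_wpM2l.
lra.
Qed.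

Section pointwise.
Context {R : realType}.
Variables (p q : R).
Hypotheses (p1 : 1 <= p) (p2 : p <= 2) (q1 : 1 <= q).

(** The right-hand side is nonnegative where the indicator vanishes, so that it
    can be integrated over the whole line and its linear term disappears when
    the law is centred.  The same applies to [tilt_upper_pointwise]. *)
Lemma tilt_lower_pointwise (K b x : R) : 0 < b -> 1 <= K ->
  \1_(`](- b), +oo[%classic) x * expR (- (K / b) * x) <=
  1 + (- (K / b)) * x + expR K * (K / b) `^ p * `|x| `^ p.
Proof.
move=> b0 K1; have Kb : 0 <= K / b by rewrite divr_ge0 ?(ltW b0)//; lra.
have rE : (K / b) `^ p * `|x| `^ p = `|- (K / b) * x| `^ p.
  by rewrite mulNr normrN normrM (ger0_norm Kb) [RHS]powRM.
rewrite -mulrA rE indicE; case: (boolP (x \in _)).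
  rewrite inE /= in_itv/= andbT mul1r => xb; apply: expR_le_taylor => //.
  rewrite mulNr -mulrN -[leRHS](@divfK _ b) ?gt_eqF//.
  by rewrite ler_wpM2l//; lra.
rewrite notin_setE /= in_itv/= andbT => /negP; rewrite -leNgt => xb.
rewrite mul0r addr_ge0 ?mulr_ge0 ?expR_ge0 ?powR_ge0// mulNr -mulrN.
by rewrite addr_ge0// mulr_ge0//; lra.
Qed.

(** The three remainders account for [phi * x <= q], for larger [x] up to [y],
    and for [x] between [y] and [b]. *)
Lemma tilt_upper_pointwise (phi y b x : R) : 0 < phi -> 0 < y -> 0 < b ->
  \1_(`]-oo, b[%classic) x * expR (phi * x) <=
  1 + phi * x + (expR q * phi `^ p * `|x| `^ p +
    (y `^ (- q) * expR (phi * y) * (Num.max x 0) `^ q +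
     expR (phi * b) * \1_(`]y, b[%classic) x)).
Proof.
move=> phi0 y0 b0.
have rE : phi `^ p * `|x| `^ p = `|phi * x| `^ p.
  by rewrite normrM (ger0_norm (ltW phi0)) [RHS]powRM// ltW.
rewrite -mulrA rE.
set t1 := _ * `|_| `^ _; set t2 := _ * (Num.max _ _) `^ _; set t3 := _ * \1__ _.
have t10 : 0 <= t1 by rewrite mulr_ge0 ?expR_ge0 ?powR_ge0.
have t20 : 0 <= t2 by rewrite !mulr_ge0 ?expR_ge0 ?powR_ge0.
have t30 : 0 <= t3 by rewrite mulr_ge0 ?expR_ge0.
rewrite indicE; case: (boolP (x \in _)); last first.
  rewrite notin_setE /= in_itv/= => /negP; rewrite -leNgt => xb.
  by rewrite mul0r !addr_ge0// mulr_ge0 ?(ltW phi0)// (le_trans (ltW b0)).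
rewrite inE /= in_itv/= mul1r => xb.
have [uq|uq] := leP (phi * x) q.
  by apply: (le_trans (expR_le_taylor p1 p2 q1 uq)); rewrite -/t1; lra.
have u0 : 0 < phi * x := le_lt_trans (le_trans ler01 q1) uq.
have x0 : 0 < x by rewrite -(pmulr_rgt0 _ phi0).
have [xy|yx] := leP x y.
  apply: (@le_trans _ _ t2); last by rewrite -[leLHS]add0r -[t2]add0r; lra.
  apply: (le_trans (expR_le_power (le_trans ler01 q1) x0 xy (ltW uq))).
  rewrite /t2 (max_idPl (ltW x0)) powRM ?invr_ge0 ?(ltW x0) ?(ltW y0)//.
  have -> : y `^ (- q) = y^-1 `^ q.
    by rewrite -[y^-1](powR_inv1 (ltW y0)) -powRrM mulN1r.
  by rewrite [leRHS]mulrC mulrA.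
apply: (@le_trans _ _ t3); last lra.
rewrite /t3 indicE mem_set /= ?in_itv/= ?yx// mulr1 ler_expR ler_pM2l//.
exact: ltW.
Qed.

End pointwise.

Lemma integral_le_centered (R : realType) (F : probability R R) (H r : R -> R)
    (a rho : R) :
  F.-integrable setT (EFin : R -> \bar R) -> (\int[F]_x x%:E = 0)%E ->
  measurable_fun setT H -> (forall x, 0 <= H x) ->
  measurable_fun setT r -> (forall x, 0 <= r x) ->
  (\int[F]_x (r x)%:E <= rho%:E)%E ->
  (forall x, H x <= 1 + a * x + r x) ->
  (\int[F]_x (H x)%:E <= (1 + rho)%:E)%E.
Proof.
move=> iF F0 mH H0 mr r0 rrho Hr.
have ir : F.-integrable setT (EFin \o r).
  apply/integrableP; split; first exact/measurable_EFinP.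
  under eq_integral do rewrite /= ger0_norm//.
  exact: le_lt_trans rrho (ltry _).
have i1 : F.-integrable setT (EFin \o cst (1 : R)).
  by apply: finite_measure_integrable_cst.
have ia : F.-integrable setT (fun x => a%:E * x%:E)%E by exact: integrableZl.
have i1a : F.-integrable setT (fun x => 1%:E + a%:E * x%:E)%E.
  exact: integrableD.
apply: (@le_trans _ _ (\int[F]_x ((1%:E + a%:E * x%:E) + (r x)%:E))%E).
  apply: ge0_le_integral => //.
  - by move=> x _; rewrite lee_fin.
  - exact/measurable_EFinP.
  - exact: (measurable_int F (integrableD measurableT i1a ir)).
  - by move=> x _; rewrite -EFinM -!EFinD lee_fin.
rewrite integralD// integralD// integralZl// F0 mule0 adde0.
by rewrite integral_one EFinD leeD.
Qed.

Section moments.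
Context {R : realType}.
Variables (F : probability R R).
Hypotheses (iF : F.-integrable setT (EFin : R -> \bar R))
  (F0 : (\int[F]_x x%:E = 0)%E).
Variables (p q mp mq : R).
Hypotheses (p1 : 1 <= p) (p2 : p <= 2) (q1 : 1 <= q).
Hypothesis Hp : (\int[F]_x (`|x| `^ p)%:E <= mp%:E)%E.

Let mnp : measurable_fun setT (fun x : R => `|x| `^ p).
Proof. exact: (measurableT_comp (measurable_powR p) (@normr_measurable R setT)). Qed.

Lemma lower_tilt_integral (K b : R) : 0 < b -> 1 <= K ->
  (\int[F]_x (\1_(`](- b)%R, +oo[%classic) x * expR (- (K / b) * x))%:E <=
   (1 + expR K * (K / b) `^ p * mp)%:E)%E.
Proof.
move=> b0 K1.
apply: (@integral_le_centered _ F _ (fun x => expR K * (K / b) `^ p * `|x| `^ p)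
   (- (K / b))) => //.
- apply: measurable_funM; first exact: measurable_indic.
  apply: measurableT_comp; first exact: measurable_expR.
  exact: mulrl_measurable.
- by apply: measurable_funM.
- by move=> x; rewrite !mulr_ge0 ?expR_ge0 ?powR_ge0.
- under eq_integral do rewrite EFinM.
  rewrite ge0_integralZl_EFin//.
  + by rewrite [leRHS]EFinM lee_wpmul2l// lee_fin mulr_ge0 ?expR_ge0 ?powR_ge0.
  + exact/measurable_EFinP.
  + by rewrite mulr_ge0 ?expR_ge0 ?powR_ge0.
- by move=> x; exact: tilt_lower_pointwise.
Qed.

Lemma markov_abs (b : R) : 0 < b ->
  (F [set x | (b <= `|x|)%R] <= (b `^ (- p) * mp)%:E)%E.
Proof.
move=> b0.
apply: (@le_trans _ _ (\int[F]_x (b `^ (- p) * `|x| `^ p)%:E)%E).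
  apply: measure_le_integral; first exact: measurable_norm_ge.
  - exact: measurable_funM.
  - by move=> x; rewrite mulr_ge0 ?powR_ge0.
  - move=> x /= bx; rewrite powRN mulrC ler_pdivlMr ?powR_gt0// mul1r.
    by rewrite ge0_ler_powR ?nnegrE ?(ltW b0)// (le_trans ler01 p1).
under eq_integral do rewrite EFinM.
rewrite ge0_integralZl_EFin ?powR_ge0//.
- by rewrite [leRHS]EFinM lee_wpmul2l// lee_fin powR_ge0.
- exact/measurable_EFinP.
Qed.

Hypothesis Hq : (\int[F]_x ((Num.max x 0) `^ q)%:E <= mq%:E)%E.

Let mmq : measurable_fun setT (fun x : R => (Num.max x 0) `^ q).
Proof.
apply: (measurableT_comp (measurable_powR q)).
by apply: measurable_maxr => //; exact: measurable_id.
Qed.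

Lemma upper_tilt_integral (phi y b : R) : 0 < phi -> 0 < y -> y < b ->
  (\int[F]_x (\1_(`]-oo, b[%classic) x * expR (phi * x))%:E <=
   (1 + (expR q * phi `^ p * mp + (y `^ (- q) * expR (phi * y) * mq +
      expR (phi * b) * (tail F y - tail F b))))%:E)%E.
Proof.
move=> phi0 y0 yb; have b0 : 0 < b by exact: lt_trans yb.
apply: (@integral_le_centered _ F _ (fun x => expR q * phi `^ p * `|x| `^ p +
    (y `^ (- q) * expR (phi * y) * (Num.max x 0) `^ q +
     expR (phi * b) * \1_(`]y, b[%classic) x))  phi) => //.
- apply: measurable_funM; first exact: measurable_indic.
  apply: measurableT_comp; first exact: measurable_expR.
  exact: mulrl_measurable.
- apply: measurable_funD; first exact: measurable_funM.
  apply: measurable_funD; first exact: measurable_funM.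
  by apply: measurable_funM => //; exact: measurable_indic.
- by move=> x; rewrite !addr_ge0// !mulr_ge0 ?expR_ge0 ?powR_ge0.
- have c10 : 0 <= expR q * phi `^ p by rewrite mulr_ge0 ?expR_ge0 ?powR_ge0.
  have c20 : 0 <= y `^ (- q) * expR (phi * y).
    by rewrite mulr_ge0 ?expR_ge0 ?powR_ge0.
  have m1 : measurable_fun setT (fun x : R => (expR q * phi `^ p * `|x| `^ p)%:E).
    by apply/measurable_EFinP; exact: measurable_funM.
  have m2 : measurable_fun setT
      (fun x : R => (y `^ (- q) * expR (phi * y) * (Num.max x 0) `^ q)%:E).
    by apply/measurable_EFinP; exact: measurable_funM.
  have m3 : measurable_fun setT
      (fun x : R => (expR (phi * b) * \1_(`]y, b[%classic) x)%:E).
    by apply/measurable_EFinP; apply: measurable_funM.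
  have p1' x : (0 <= (expR q * phi `^ p * `|x| `^ p)%:E)%E.
    by rewrite lee_fin mulr_ge0// powR_ge0.
  have p2' x : (0 <= (y `^ (- q) * expR (phi * y) * (Num.max x 0) `^ q)%:E)%E.
    by rewrite lee_fin mulr_ge0// powR_ge0.
  have p3' x : (0 <= (expR (phi * b) * \1_(`]y, b[%classic) x)%:E)%E.
    by rewrite lee_fin mulr_ge0// expR_ge0.
  under eq_integral do rewrite !EFinD.
  rewrite ge0_integralD//; last 2 first.
  + by move=> x _; exact: adde_ge0.
  + exact: emeasurable_funD.
  rewrite ge0_integralD// !EFinD; apply: leeD; last apply: leeD.
  + under eq_integral do rewrite EFinM.
    rewrite ge0_integralZl_EFin//.
    * by rewrite [leRHS]EFinM lee_wpmul2l.
    * exact/measurable_EFinP.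
  + under eq_integral do rewrite EFinM.
    rewrite ge0_integralZl_EFin//.
    * by rewrite [leRHS]EFinM lee_wpmul2l.
    * by move=> x _; rewrite lee_fin powR_ge0.
    * exact/measurable_EFinP.
  + under eq_integral do rewrite EFinM.
    rewrite ge0_integralZl_EFin ?expR_ge0//; last first.
      by apply/measurable_EFinP; exact: measurable_indic.
    rewrite integral_indic// setIT [leRHS]EFinM lee_wpmul2l ?lee_fin ?expR_ge0//.
    have mi (z : R) : measurable (`]z, +oo[%classic : set R).
      exact: measurable_itv.
    have fy z : F `]z, +oo[%classic \is a fin_num by exact: fin_num_measure.
    rewrite EFinB /tail !fineK// leeBrDr//.
    rewrite -measureU//; last first.
      apply/seteqP; split=> x //=; rewrite !in_itv/= andbT => -[/andP[_ xb]].
      by move/(lt_trans xb); rewrite ltxx.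
    apply: le_measure; rewrite ?inE//; first exact: measurableU.
    move=> x /=; rewrite !in_itv/= !andbT => -[/andP[]//|].
    exact: lt_trans.
- by move=> x; exact: tilt_upper_pointwise.
Qed.

End moments.

(** * Regular variation and moments *)

Lemma near_pinfty_powR_ge (R : realType) (s M : R) : 0 < s ->
  \forall b \near +oo, M <= b `^ s.
Proof.
move=> s0; have [M0|M0] := leP M 0.
  by near=> b; rewrite (le_trans M0)// powR_ge0.
near=> b.
rewrite -[M]powRr1 ?(ltW M0)// -(@mulVf _ s) ?gt_eqF// powRrM.
rewrite ge0_ler_powR ?nnegrE ?powR_ge0 ?(ltW s0)//.
Unshelve. all: end_near. Qed.

(** Regular variation at infinity with index [- alpha], in terms of the
    pointwise limits only. *)
Definition regularly_varying (R : realType) (alpha : R) (T : R -> R) :=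
  forall t : R, 0 < t -> T (t * x) / T x @[x --> +oo] --> t `^ (- alpha).

Lemma near_pinfty_ex (R : realType) (P : R -> Prop) : (\forall x \near +oo, P x) ->
  exists2 x0 : R, 1 <= x0 & forall x, x0 <= x -> P x.
Proof.
move=> [M [_ MP]]; exists (Num.max 1 (M + 1)); first by rewrite le_max lexx.
by move=> x; rewrite ge_max => /andP[_ Mx]; apply: MP; lra.
Qed.

Section potter.
Context {R : realType}.
Variables (alpha : R) (T : R -> R).
Hypotheses (T0 : forall x, 0 < T x) (Tni : {homo T : x y /~ x <= y})
  (Trv : regularly_varying alpha T).

(** One half of the Potter bounds, by monotonicity and iteration of the
    inequality between [T (2 * x)] and [T x]. *)
Lemma regularly_varying_upper (s : R) : 0 < s -> 0 <= alpha - s ->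
  exists2 C : R, 0 < C & \forall x \near +oo, T x <= C * x `^ (- (alpha - s)).
Proof.
set r := alpha - s => s0 r0.
have : 2 `^ (- alpha) < 2 `^ (- r) :> R.
  rewrite /powR gt_eqF// ltr_expR ltr_pM2r ?ln_gt0 ?ltr1n//.
  by rewrite /r; lra.
move=> /(cvgr_lt _ (Trv (ltr0Sn R 1))) /near_pinfty_ex [x0 x01 H].
have x00 : 0 < x0 by lra.
pose C := T x0 * (2 * x0) `^ r.
exists C; first by rewrite mulr_gt0// powR_gt0// mulr_gt0.
have main n x : x0 <= x -> x <= 2 ^+ n.+1 * x0 -> T x * x `^ r <= C.
  elim: n x => [|n IH] x x0x xn.
    rewrite ler_pM ?powR_ge0 ?(ltW (T0 _))//; first exact: Tni.
    by rewrite expr1 in xn; rewrite ge0_ler_powR ?nnegrE//; lra.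
  have [x2|x2] := leP x (2 * x0).
    rewrite ler_pM ?powR_ge0 ?(ltW (T0 _))//; first exact: Tni.
    by rewrite ge0_ler_powR ?nnegrE//; lra.
  have h1 : x0 <= x / 2 by lra.
  have h2 : x / 2 <= 2 ^+ n.+1 * x0 by move: xn; rewrite exprS; lra.
  apply: le_trans (IH _ h1 h2).
  have := H _ h1; rewrite ltr_pdivrMr// mulrCA mulfV ?mulr1// => /ltW h3.
  have -> : x `^ r = (x / 2) `^ r * 2 `^ r.
    rewrite -powRM//; last lra.
    by rewrite divfK.
  apply: (@le_trans _ _ (2 `^ (- r) * T (x / 2) * ((x / 2) `^ r * 2 `^ r))).
    by rewrite ler_wpM2r// mulr_ge0 ?powR_ge0.
  rewrite powRN [leLHS](_ : _ = T (x / 2) * (x / 2) `^ r)//.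
  have w0 : (2 : R) `^ r != 0 by rewrite gt_eqF// powR_gt0.
  by field.
near=> x.
have x0x : x0 <= x by [].
have xp : 0 < x by lra.
rewrite powRN ler_pdivlMr ?powR_gt0//.
apply: (main (Num.truncn (x / x0)).+1) => //.
rewrite -ler_pdivrMr//; apply: ltW.
have := truncnS_gt (x / x0); set m := Num.truncn _ => h.
rewrite (lt_trans h)// -natrX ltr_nat.
by rewrite (leq_trans (ltn_expl m.+1 (ltnSn 1)))// leq_exp2l.
Unshelve. all: end_near. Qed.

(** The other half; the constant is absorbed in the exponent. *)
Lemma regularly_varying_lower (s : R) : 0 < s -> 0 <= alpha ->
  \forall x \near +oo, x `^ (- (alpha + s)) <= T x.
Proof.
move=> s0 a0; pose r := alpha + s / 2.
have : 2 `^ (- r) < 2 `^ (- alpha) :> R.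
  rewrite /powR gt_eqF// ltr_expR ltr_pM2r ?ln_gt0 ?ltr1n//.
  by rewrite /r; lra.
move=> /(cvgr_gt _ (Trv (ltr0Sn R 1))) /near_pinfty_ex [x0 x01 H].
have x00 : 0 < x0 by lra.
have r0 : 0 <= r by rewrite /r; lra.
pose C := T (2 * x0) * x0 `^ r.
have C0 : 0 < C by rewrite mulr_gt0// powR_gt0.
have main n x : x0 <= x -> x <= 2 ^+ n.+1 * x0 -> C <= T x * x `^ r.
  have base y : x0 <= y -> y <= 2 * x0 -> C <= T y * y `^ r.
    move=> h1 h2; rewrite ler_pM ?powR_ge0 ?(ltW (T0 _))//; first exact: Tni.
    by rewrite ge0_ler_powR ?nnegrE//; lra.
  elim: n x => [|n IH] x x0x xn; first by apply: base; rewrite ?expr1 in xn *.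
  have [x2|x2] := leP x (2 * x0); first exact: base.
  have h1 : x0 <= x / 2 by lra.
  have h2 : x / 2 <= 2 ^+ n.+1 * x0 by move: xn; rewrite exprS; lra.
  apply: (le_trans (IH _ h1 h2)).
  have := H _ h1; rewrite ltr_pdivlMr// [2 * (x / 2)]mulrCA mulfV ?mulr1// => /ltW h3.
  have -> : x `^ r = (x / 2) `^ r * 2 `^ r.
    rewrite -powRM//; last lra.
    by rewrite divfK.
  apply: (@le_trans _ _ (2 `^ (- r) * T (x / 2) * ((x / 2) `^ r * 2 `^ r))).
    rewrite powRN [leRHS](_ : _ = T (x / 2) * (x / 2) `^ r)//.
    have w0 : (2 : R) `^ r != 0 by rewrite gt_eqF// powR_gt0.
  by field.
  by rewrite ler_wpM2r// mulr_ge0 ?powR_ge0.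
near=> x.
have x0x : x0 <= x by [].
have xp : 0 < x by lra.
apply: (@le_trans _ _ (C * x `^ (- r))).
  rewrite (_ : alpha + s = r + s / 2); last by rewrite /r; lra.
  rewrite opprD powRD; last by rewrite (gt_eqF xp) implybT.
  rewrite mulrC ler_wpM2r ?powR_ge0// powRN.
  rewrite -[C]invrK lef_pV2 ?posrE ?powR_gt0 ?invr_gt0//.
  by near: x; apply: near_pinfty_powR_ge; lra.
rewrite powRN ler_pdivrMr ?powR_gt0//.
apply: (main (Num.truncn (x / x0)).+1) => //.
rewrite -ler_pdivrMr//; apply: ltW.
have := truncnS_gt (x / x0); set m := Num.truncn _ => h.
rewrite (lt_trans h)// -natrX ltr_nat.
by rewrite (leq_trans (ltn_expl m.+1 (ltnSn 1)))// leq_exp2l.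
Unshelve. all: end_near. Qed.

End potter.

Lemma geometric_sum_le (R : realType) (z : R) n : 0 <= z -> z < 1 ->
  \sum_(0 <= k < n) z ^+ k <= (1 - z)^-1.
Proof.
move=> z0 z1; rewrite -[leRHS]mul1r ler_pdivlMr; last lra.
rewrite (_ : _ * _ = 1 - z ^+ n); first by rewrite lerBlDr lerDl exprn_ge0.
elim: n => [|n IH]; first by rewrite big_geq// expr0; lra.
by rewrite big_nat_recr//= mulrDl IH exprS; lra.
Qed.

(** Moments from a power bound on the tail: [g `^ q] is at most
    [1 + \sum_k (2 ^+ k.+1) `^ q * \1_(2 ^+ k < g)], whose integral is bounded
    by a geometric series. *)
Lemma tail_moment_finite (R : realType) d (T : measurableType d)
    (F : probability T R) (g : T -> R) (C r q : R) :
  measurable_fun setT g -> (forall x, 0 <= g x) -> 0 < q -> q < r -> 0 <= C ->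
  (forall t : R, (1 <= t)%R -> F [set x | (t < g x)%R] <= (C * t `^ (- r))%:E)%E ->
  exists2 m : R, 0 <= m & (\int[F]_x (g x `^ q)%:E <= m%:E)%E.
Proof.
move=> mg g0 q0 qr C0 HF.
pose G k : set T := [set x | 2 ^+ k < g x].
have mG k : measurable (G k).
  rewrite (_ : G k = setT `&` g @^-1` `]2 ^+ k, +oo[%classic).
    by apply: mg => //; exact: measurable_itv.
  by apply/seteqP; split=> x; rewrite /G/= in_itv/= andbT => // -[].
pose f (k : nat) x : \bar R := ((2 ^+ k.+1) `^ q * \1_(G k) x)%:E.
have f0 k x : (0 <= f k x)%E by rewrite lee_fin mulr_ge0// powR_ge0.
have mf k : measurable_fun setT (f k).
  apply/measurable_EFinP; apply: measurable_funM => //.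
have mfs : measurable_fun setT (fun x => \sum_(k <oo) f k x)%E.
  by apply: ge0_emeasurable_sum.
pose z : R := 2 `^ (q - r).
have z0 : 0 <= z by exact: powR_ge0.
have z1 : z < 1.
  rewrite /z /powR gt_eqF// -[ltRHS]expR0 ltr_expR.
  by rewrite pmulr_llt0 ?ln_gt0 ?ltr1n//; lra.
pose M := 2 `^ q * C * (1 - z)^-1.
have M0 : 0 <= M by rewrite !mulr_ge0 ?powR_ge0// invr_ge0; lra.
exists (1 + M); first by rewrite addr_ge0.
apply: (@le_trans _ _ (\int[F]_x (1%:E + \sum_(k <oo) f k x))%E).
  apply: ge0_le_integral => //.
  - by move=> x _; rewrite lee_fin powR_ge0.
  - apply/measurable_EFinP.
    exact: (measurableT_comp (measurable_powR q) mg).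
  - exact: emeasurable_funD.
  - move=> x _; have [g1|g1] := leP (g x) 1.
      apply: (@le_trans _ _ 1%:E); last by rewrite leeDl// nneseries_ge0.
      have [->|gn0] := eqVneq (g x) 0; first by rewrite powR0 ?gt_eqF// lee_fin.
      rewrite lee_fin -[leRHS](powRr0 (g x)) ger_powR ?(ltW q0)//.
      by rewrite lt_neqAle eq_sym gn0 g0.
    have [k /andP[k1 k2]] : exists k, 2 ^+ k < g x <= 2 ^+ k.+1.
      have ex : exists n, g x <= 2 ^+ n.
        exists (Num.truncn (g x)).+1; apply: ltW; apply: (lt_le_trans (truncnS_gt _)).
        by rewrite -natrX ler_nat ltnW// ltn_expl.
      case: (ex_minnP ex) => -[|k] gk kmin; first by move: gk g1; rewrite expr0; lra.
      by exists k; rewrite gk andbT ltNge; apply/negP => /kmin; rewrite ltnn.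
    apply: (@le_trans _ _ (f k x)).
      by rewrite /f indicE mem_set// mulr1 lee_fin ge0_ler_powR ?nnegrE ?(ltW q0).
    rewrite -[leLHS]add0e leeD//.
    apply: le_trans (nneseries_lim_ge k.+1 _) => //.
    by rewrite big_nat_recr//= leeDr// sume_ge0.
rewrite ge0_integralD//; last by move=> x _; rewrite nneseries_ge0.
rewrite integral_one EFinD leeD2l//.
rewrite integral_nneseries//.
apply: lime_le; first by apply: is_cvg_nneseries => k _ _; exact: integral_ge0.
near=> n.
apply: (@le_trans _ _ (\sum_(0 <= k < n) (2 `^ q * C * z ^+ k)%:E)%E).
  apply: lee_sum => k _; rewrite /f.
  under eq_integral do rewrite EFinM.
  rewrite ge0_integralZl_EFin ?powR_ge0//; last by apply/measurable_EFinP.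
  rewrite integral_indic// setIT.
  apply: (@le_trans _ _ (((2 ^+ k.+1) `^ q)%:E * (C * (2 ^+ k) `^ (- r))%:E)%E).
    rewrite lee_wpmul2l ?lee_fin ?powR_ge0//; apply: HF.
    by rewrite exprn_ege1// ler1n.
  have p2 : 0 < 2 ^+ k :> R by rewrite exprn_gt0.
  have E : (2 ^+ k.+1) `^ q * (2 ^+ k) `^ (- r) = 2 `^ q * z ^+ k :> R.
    rewrite exprS powRM ?(ltW p2)// -mulrA -powRD ?(gt_eqF p2) ?implybT//.
    congr (_ * _); rewrite /z -[2 ^+ k]powR_mulrn//.
    by rewrite -[RHS]powR_mulrn ?powR_ge0// -!powRrM mulrC.
  by rewrite -EFinM lee_fin mulrCA E mulrCA mulrA.
rewrite sumEFin lee_fin -mulr_sumr /M ler_wpM2l ?mulr_ge0 ?powR_ge0//.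
exact: geometric_sum_le.
Unshelve. all: end_near. Qed.

Lemma tail_ge0 (R : realType) (F : probability R R) x : 0 <= tail F x.
Proof. exact: fine_ge0. Qed.

Lemma tail_nonincreasing (R : realType) (F : probability R R) :
  {homo tail F : x y /~ x <= y}.
Proof.
move=> x y yx; rewrite /tail fine_le ?fin_num_measure//.
apply: le_measure; rewrite ?inE// => z /=; rewrite !in_itv/= !andbT.
exact: le_lt_trans.
Qed.

Lemma near_tail_moment_finite (R : realType) d (T : measurableType d)
    (F : probability T R) (g : T -> R) (C r q : R) :
  measurable_fun setT g -> (forall x, 0 <= g x) -> 0 < q -> q < r -> 0 <= C ->
  (\forall t \near +oo, (F [set x | (t < g x)%R] <= (C * t `^ (- r))%:E)%E) ->
  exists2 m : R, 0 < m & (\int[F]_x (g x `^ q)%:E <= m%:E)%E.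
Proof.
move=> mg g0 q0 qr C0 /near_pinfty_ex[x0 x01 HF].
have x00 : 0 < x0 by lra.
have r0 : 0 <= r by lra.
have [m m0 Hm] : exists2 m : R, 0 <= m & (\int[F]_x (g x `^ q)%:E <= m%:E)%E.
  apply: (@tail_moment_finite _ _ _ F g (Num.max C (x0 `^ r)) r q) => //.
    by rewrite le_max C0.
  move=> t t1; have [tx|tx] := leP x0 t.
    apply: (le_trans (HF _ tx)); rewrite lee_fin ler_wpM2r ?powR_ge0//.
    by rewrite le_max lexx.
  apply: (@le_trans _ _ 1%E).
    apply: probability_le1.
    rewrite (_ : mkset _ = setT `&` g @^-1` `]t, +oo[%classic).
      by apply: mg => //; exact: measurable_itv.
    by apply/seteqP; split=> x /=; rewrite in_itv/= andbT => // -[].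
  have t0 : 0 < t by lra.
  rewrite lee_fin powRN ler_pdivlMr ?powR_gt0// mul1r le_max.
  by apply/orP; right; rewrite ge0_ler_powR ?nnegrE ?(ltW t0) ?(ltW x00) ?(ltW tx).
exists (m + 1); first lra.
by apply: (le_trans Hm); rewrite lee_fin; lra.
Qed.

Section tail_of_slowly_varying.
Context {R : realType}.
Variables (F : probability R R) (alpha : R) (L : R -> R).
Hypotheses (Lsv : slowly_varying L)
  (tailE : forall x, 0 < x -> tail F x = x `^ (- alpha) * L x).

Lemma slowly_varying_neq0 : \forall x \near +oo, L x != 0.
Proof.
near=> x.
have : 2^-1 < L (1 * x) / L x.
  near: x; apply: (cvgr_gt _ (Lsv ltr01)).
  by rewrite invf_lt1 ?ltr1n.
by apply: contraTneq => ->; rewrite invr0 mulr0 -leNgt invr_ge0.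
Unshelve. all: end_near. Qed.

Lemma tail_gt0 x : 0 < tail F x.
Proof.
have [x0 x01 H] := near_pinfty_ex slowly_varying_neq0.
pose y := Num.max x0 x.
have y0 : 0 < y by rewrite lt_max; apply/orP; left; lra.
apply: (@lt_le_trans _ _ (tail F y)); last first.
  by apply: tail_nonincreasing; rewrite le_max lexx orbT.
rewrite lt_neqAle tail_ge0 andbT eq_sym tailE// mulf_neq0//.
  by rewrite gt_eqF// powR_gt0.
by apply: H; rewrite le_max lexx.
Qed.

Lemma tail_regularly_varying : regularly_varying alpha (tail F).
Proof.
move=> t t0.
have H : t `^ (- alpha) * (L (t * x) / L x) @[x --> +oo] --> t `^ (- alpha).
  rewrite -[X in _ --> X]mulr1; apply: cvgMl_tmp; exact: Lsv.
apply: cvg_trans H; apply: near_eq_cvg; near=> x.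
have x0 : 0 < x by [].
have L0 : L x != 0 by near: x; exact: slowly_varying_neq0.
rewrite !tailE ?mulr_gt0// powRM ?(ltW x0) ?(ltW t0)//.
have p0 : x `^ (- alpha) != 0 by rewrite gt_eqF// powR_gt0.
by field; rewrite ?L0 ?p0.
Unshelve. all: end_near. Qed.

End tail_of_slowly_varying.

Lemma right_moment_finite (R : realType) (F : probability R R) (alpha q : R) :
  (forall x, 0 < tail F x) -> regularly_varying alpha (tail F) ->
  1 <= q -> q < alpha ->
  exists2 mq : R, 0 <= mq & (\int[F]_x ((Num.max x 0) `^ q)%:E <= mq%:E)%E.
Proof.
move=> T0 Trv q1 qa; pose s := (alpha - q) / 2.
have s0 : 0 < s by rewrite divr_gt0//; lra.
have rs : 0 <= alpha - s by rewrite /s; lra.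
have [C C0 HC] := regularly_varying_upper T0 (@tail_nonincreasing R F) Trv s0 rs.
have [m m0 Hm] : exists2 m : R, 0 < m &
    (\int[F]_x ((Num.max x 0) `^ q)%:E <= m%:E)%E.
  apply: (@near_tail_moment_finite _ _ _ F _ C (alpha - s) q).
  - by apply: measurable_maxr => //; exact: measurable_id.
  - by move=> x; rewrite le_max lexx orbT.
  - lra.
  - by rewrite /s; lra.
  - exact: ltW.
  near=> t; have t0 : 0 < t by [].
  rewrite (_ : mkset _ = `]t, +oo[%classic); last first.
    apply/seteqP; split=> x /=; rewrite in_itv/= andbT lt_max.
      by case/orP => //; lra.
    by move=> ->.
  have -> : F `]t, +oo[%classic = (tail F t)%:E.
    by rewrite /tail fineK// fin_num_measure.
  by rewrite lee_fin; near: t.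
by exists m => //; exact: ltW.
Unshelve. all: end_near. Qed.

Lemma abs_moment_finite (R : realType) (F : probability R R) (alpha p C : R) :
  (forall x, 0 < tail F x) -> regularly_varying alpha (tail F) ->
  1 <= p -> p < alpha -> 0 <= C ->
  (\forall t \near +oo, (F [set x | (x < - t)%R] <= (C * tail F t)%:E)%E) ->
  exists2 mp : R, 0 < mp & (\int[F]_x (`|x| `^ p)%:E <= mp%:E)%E.
Proof.
move=> T0 Trv p1 pa C0 Hleft; pose s := (alpha - p) / 2.
have s0 : 0 < s by rewrite divr_gt0//; lra.
have rs : 0 <= alpha - s by rewrite /s; lra.
have [C' C'0 HC] := regularly_varying_upper T0 (@tail_nonincreasing R F) Trv s0 rs.
apply: (@near_tail_moment_finite _ _ _ F _ ((1 + C) * C') (alpha - s) p) => //.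
- lra.
- by rewrite /s; lra.
- by rewrite mulr_ge0 ?(ltW C'0)//; lra.
near=> t; have t0 : 0 < t by [].
have mI (i : interval R) : measurable [set` i] by exact: measurable_itv.
have mN : measurable [set x : R | x < - t].
  rewrite (_ : mkset _ = `]-oo, (- t)%R[%classic); first exact: mI.
  by apply/seteqP; split=> x /=; rewrite in_itv.
have TE : F `]t, +oo[%classic = (tail F t)%:E.
  by rewrite /tail fineK// fin_num_measure.
apply: (@le_trans _ _ (F (`]t, +oo[%classic `|` [set x : R | x < - t]))).
  apply: le_measure; rewrite ?inE.
  - rewrite (_ : mkset _ = setT `&` (fun x : R => `|x|) @^-1` `]t, +oo[%classic).
      by apply: normr_measurable => //; exact: measurable_itv.
    by apply/seteqP; split=> x /=; rewrite in_itv/= andbT => // -[].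
  - exact: measurableU.
  move=> x /=; rewrite in_itv/= andbT ltr_normr => /orP[|]; first by left.
  by rewrite ltrNr; right.
apply: (le_trans (measureU2 _ _ mN)) => //.
have h1 : tail F t <= C' * t `^ (- (alpha - s)) by near: t.
have h2 : (F [set x | (x < - t)%R] <= (C * tail F t)%:E)%E by near: t.
rewrite [X in (X + _ <= _)%E]TE; apply: (@le_trans _ _ ((tail F t)%:E + (C * tail F t)%:E)%E).
  by rewrite leeD2l.
rewrite -EFinD lee_fin.
have -> : tail F t + C * tail F t = (1 + C) * tail F t by ring.
by rewrite -mulrA ler_wpM2l//; lra.
Unshelve. all: end_near. Qed.

(** * Uniform estimates in the regime of n at most b^gamma *)

Lemma ler1_one_plus_inv (R : realType) n : 1 <= 1 + n%:R^-1 :> R.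
Proof. by rewrite lerDl invr_ge0. Qed.

Lemma expr_one_plus_inv_le (R : realType) n :
  (1 + n%:R^-1) ^+ n <= expR 1 :> R.
Proof.
have [->|n0] := posnP n; first by rewrite expr0 -expR0 ler_expR.
apply: (@le_trans _ _ (expR n%:R^-1 ^+ n)).
  rewrite lerXn2r ?nnegrE ?expR_ge0 ?addr_ge0 ?invr_ge0//.
  exact: expR_ge1Dx.
by rewrite -expRM_natl mulfV// pnatr_eq0 -lt0n.
Qed.

Lemma near_pinfty_powRN_le (R : realType) (s e : R) : 0 < s -> 0 < e ->
  \forall b \near +oo, b `^ (- s) <= e.
Proof.
move=> s0 e0; near=> b.
have b0 : 0 < b by [].
rewrite powRN -[e]invrK lef_pV2 ?posrE ?powR_gt0 ?invr_gt0//.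
by near: b; exact: near_pinfty_powR_ge.
Unshelve. all: end_near. Qed.

Lemma ln_le_powR (R : realType) (s x : R) : 0 < s -> 0 < x ->
  ln x <= s^-1 * x `^ s.
Proof.
move=> s0 x0; rewrite ler_pdivlMl// -ln_powR ltW// ln_sublinear// powR_gt0//.
Qed.

Section asymptotics.
Context {R : realType}.
Variables (F : probability R R) (alpha gamma p mp : R).
Hypotheses (iF : F.-integrable setT (EFin : R -> \bar R))
  (F0 : (\int[F]_x x%:E = 0)%E).
Hypotheses (p1 : 1 <= p) (p2 : p <= 2) (ga : gamma < alpha)
  (gp : gamma < p) (a1 : 1 < alpha) (mp0 : 0 < mp).
Hypothesis Hp : (\int[F]_x (`|x| `^ p)%:E <= mp%:E)%E.
Hypothesis Hq : forall q, 1 <= q -> q < alpha ->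
  exists2 mq : R, 0 <= mq & (\int[F]_x ((Num.max x 0) `^ q)%:E <= mq%:E)%E.
Hypothesis T0 : forall x, 0 < tail F x.
Hypothesis Trv : regularly_varying alpha (tail F).

Local Notation T := (tail F).

(** The source of all the smallness: [n * b `^ (- p)] vanishes uniformly over
    the [n] with [n <= b `^ gamma], because [gamma < p]. *)
Lemma near_moment_rate (e : R) : 0 < e -> \forall b \near +oo,
  forall n : nat, n%:R <= b `^ gamma -> n%:R * b `^ (- p) <= e.
Proof.
move=> e0; near=> b => n nb.
have b0 : 0 < b by [].
apply: (@le_trans _ _ (b `^ (- (p - gamma)))).
  rewrite opprB powRD; last by rewrite (gt_eqF b0) implybT.
  by rewrite ler_wpM2r ?powR_ge0.
by near: b; apply: near_pinfty_powRN_le => //; rewrite subr_gt0.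
Unshelve. all: end_near. Qed.

Lemma tail_le_moment b : 0 < b -> T b <= b `^ (- p) * mp.
Proof.
move=> b0; rewrite -lee_fin; apply: le_trans (markov_abs p1 Hp b0).
rewrite /tail fineK ?fin_num_measure//; apply: le_measure; rewrite ?inE//.
  exact: measurable_norm_ge.
move=> x /=; rewrite in_itv/= andbT => bx; exact: le_trans (ltW bx) (ler_norm x).
Qed.

Lemma near_tail_small (e : R) : 0 < e -> \forall b \near +oo,
  forall n : nat, n%:R <= b `^ gamma -> n%:R * T b <= e.
Proof.
move=> e0; near=> b => n nb.
have b0 : 0 < b by [].
apply: (@le_trans _ _ (n%:R * b `^ (- p) * mp)).
  by rewrite -mulrA ler_wpM2l// tail_le_moment.
rewrite -ler_pdivlMr//; move: n nb; near: b.
by apply: near_moment_rate; rewrite divr_gt0.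
Unshelve. all: end_near. Qed.

(** The bound does not depend on [K], which may thus be taken as large as the
    Chernoff bounds require. *)
Lemma near_lower_tilt (K : R) : 1 <= K -> \forall b \near +oo,
  forall n : nat, (0 < n)%N -> n%:R <= b `^ gamma ->
  (\int[F]_x (\1_(`](- b)%R, +oo[%classic) x * expR (- (K / b) * x))%:E <=
   (1 + n%:R^-1)%:E)%E.
Proof.
move=> K1; pose M := expR K * K `^ p * mp.
have M0 : 0 < M by rewrite !mulr_gt0 ?expR_gt0 ?powR_gt0//; lra.
near=> b => n n0 nb.
have b0 : 0 < b by [].
have n0' : 0 < n%:R :> R by rewrite ltr0n.
apply: (le_trans (lower_tilt_integral iF F0 p1 p2 Hp b0 K1)).
rewrite lee_fin lerD2l -[leRHS]mul1r ler_pdivlMr//.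
rewrite powRM ?invr_ge0 ?(ltW b0)//; last lra.
have -> : b^-1 `^ p = b `^ (- p).
  by rewrite -[b^-1](powR_inv1 (ltW b0)) -powRrM mulN1r.
rewrite (_ : _ * n%:R = M * (n%:R * b `^ (- p))); last by rewrite /M; ring.
rewrite mulrC -ler_pdivlMr// mul1r; move: n nb {n0 n0'}; near: b.
by apply: near_moment_rate; rewrite invr_gt0.
Unshelve. all: end_near. Qed.

(** [(theta F n b + K / b) * b] is [K - ln (n%:R * T b)]; it grows more slowly
    than any power of [b]. *)
Lemma near_log_small (K s : R) : 0 <= K -> 0 < s -> \forall b \near +oo,
  forall n : nat, (0 < n)%N -> K - ln (n%:R * T b) <= b `^ s.
Proof.
move=> K0 s0; have a1' := a1; near=> b => n n0.
have b0 : 0 < b by [].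
have n0' : 1 <= n%:R :> R by rewrite ler1n.
have lT : - ln (n%:R * T b) <= (alpha + 1) * ln b.
  rewrite lnM ?posrE ?T0//; last lra.
  have h1 : 0 <= ln n%:R :> R by rewrite ln_ge0.
  have : ln (b `^ (- (alpha + 1))) <= ln (T b).
    rewrite ler_ln ?posrE ?powR_gt0//.
    near: b; apply: regularly_varying_lower => //; last lra.
    exact: tail_nonincreasing.
  by rewrite ln_powR; lra.
have h2 : ln b <= (s / 2)^-1 * b `^ (s / 2) by apply: ln_le_powR => //; lra.
have h3 : (alpha + 1) * ln b <= (alpha + 1) * ((s / 2)^-1 * b `^ (s / 2)).
  by rewrite ler_wpM2l//; lra.
have h4 : 1 <= b `^ (s / 2) by near: b; apply: near_pinfty_powR_ge; lra.
have h5 : K + (alpha + 1) * (s / 2)^-1 <= b `^ (s / 2).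
  by near: b; apply: near_pinfty_powR_ge; lra.
have -> : b `^ s = b `^ (s / 2) * b `^ (s / 2).
  rewrite -powRD; last by rewrite (gt_eqF b0) implybT.
  by congr powR; lra.
set B := b `^ (s / 2) in h2 h3 h4 h5 *.
apply: (@le_trans _ _ ((K + (alpha + 1) * (s / 2)^-1) * B)); last first.
  by rewrite ler_wpM2r//; lra.
rewrite mulrDl; apply: lerD; last by rewrite -mulrA (le_trans lT).
by rewrite -[leLHS]mulr1 ler_wpM2l.
Unshelve. all: end_near. Qed.

(** The next three lemmas bound the remainders of [upper_tilt_integral] at
    [phi := theta F n b + K / b] and [y := t * b]. *)
Lemma near_bulk_term (K q : R) : 0 <= K -> \forall b \near +oo,
  forall n : nat, (0 < n)%N -> n%:R <= b `^ gamma ->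
  n%:R * (expR q * ((K - ln (n%:R * T b)) / b) `^ p * mp) <= 3^-1.
Proof.
move=> K0; pose s := (p - gamma) / (2 * p); pose M := expR q * mp.
have pp : 0 < p by rewrite (lt_le_trans ltr01).
have gp' := gp.
have s0 : 0 < s by rewrite divr_gt0//; lra.
have M0 : 0 < M by rewrite mulr_gt0 ?expR_gt0.
near=> b => n n0 nb.
have b0 : 0 < b by [].
have c1 : n%:R * T b <= 1 by move: n nb {n0}; near: b; exact: near_tail_small.
have ls : K - ln (n%:R * T b) <= b `^ s.
  by move: n n0 {nb c1}; near: b; exact: near_log_small.
set l := K - _ in ls *.
have l0 : 0 <= l by have := ln_le0 c1; rewrite /l; lra.
rewrite powRM ?invr_ge0 ?(ltW b0)//.
have -> : b^-1 `^ p = b `^ (- p).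
  by rewrite -[b^-1](powR_inv1 (ltW b0)) -powRrM mulN1r.
have lp : l `^ p <= b `^ (s * p).
  by rewrite powRrM ge0_ler_powR ?nnegrE ?powR_ge0// ltW.
apply: (@le_trans _ _ (M * (b `^ gamma * b `^ (s * p) * b `^ (- p)))).
  rewrite (_ : _ * _ = M * (n%:R * l `^ p * b `^ (- p))); last by rewrite /M; ring.
  by rewrite ler_wpM2l ?(ltW M0)// ler_wpM2r ?powR_ge0// ler_pM ?powR_ge0.
rewrite -!powRD; try by rewrite (gt_eqF b0) implybT.
rewrite mulrC -ler_pdivlMr//.
have -> : gamma + s * p - p = - ((p - gamma) / 2).
  by rewrite /s; field; rewrite gt_eqF.
by near: b; apply: near_pinfty_powRN_le; rewrite ?divr_gt0//; lra.
Unshelve. all: end_near. Qed.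

Lemma near_middle_term (K t q mq : R) : 0 <= K -> 0 < t -> t < 1 -> 0 <= mq ->
  alpha - (1 - t) * (alpha - gamma) / 4 <= q -> \forall b \near +oo,
  forall n : nat, (0 < n)%N -> n%:R <= b `^ gamma ->
  n%:R * ((t * b) `^ (- q) * expR ((K - ln (n%:R * T b)) * t) * mq) <= 3^-1.
Proof.
set w := (1 - t) * _ / 4 => K0 t0 t1 mq0 wq.
have ga' := ga; have a1' := a1.
have w0 : 0 < w by rewrite divr_gt0// mulr_gt0//; lra.
pose M := t `^ (- q) * expR (K * t) * (mq + 1).
have M0 : 0 < M by rewrite !mulr_gt0 ?powR_gt0 ?expR_gt0//; lra.
near=> b => n n0 nb.
have b1 : 1 <= b by [].
have b0 : 0 < b by lra.
have n0' : 0 < n%:R :> R by rewrite ltr0n.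
have -> : expR ((K - ln (n%:R * T b)) * t) =
    expR (K * t) * (n%:R `^ (- t) * T b `^ (- t)).
  rewrite -powRM ?(ltW n0') ?(ltW (T0 b))//.
  rewrite /powR gt_eqF ?mulr_gt0// -expRD; congr expR; ring.
rewrite powRM ?(ltW t0) ?(ltW b0)//.
have Tb : T b `^ (- t) <= b `^ ((alpha + w) * t).
  rewrite !powRN -[leRHS]invrK lef_pV2 ?posrE ?powR_gt0 ?invr_gt0 ?powR_gt0//.
  rewrite -powRN -mulNr powRrM ge0_ler_powR ?nnegrE ?powR_ge0 ?(ltW t0)//.
    by rewrite ltW.
  near: b; apply: regularly_varying_lower => //; last lra.
  exact: tail_nonincreasing.
have nt : n%:R * n%:R `^ (- t) <= b `^ (gamma * (1 - t)).
  rewrite -{1}[n%:R]powRr1 ?(ltW n0')// -powRD; last by rewrite (gt_eqF n0') implybT.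
  by rewrite powRrM ge0_ler_powR ?nnegrE ?powR_ge0//; lra.
have bq : b `^ (- q) <= b `^ (- (alpha - w)) by rewrite ler_powR//; lra.
apply: (@le_trans _ _ (M * (b `^ (gamma * (1 - t)) * b `^ ((alpha + w) * t) *
    b `^ (- (alpha - w))))).
  rewrite (_ : _ * _ = (t `^ (- q) * expR (K * t) * mq) *
     (n%:R * n%:R `^ (- t) * T b `^ (- t) * b `^ (- q))); last by ring.
  apply: ler_pM.
  - by rewrite !mulr_ge0 ?powR_ge0 ?expR_ge0.
  - by rewrite !mulr_ge0 ?powR_ge0// ltW.
  - by rewrite ler_wpM2l ?mulr_ge0 ?powR_ge0 ?expR_ge0//; lra.
  - apply: ler_pM => //; rewrite ?mulr_ge0 ?powR_ge0 ?(ltW n0')//.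
    by apply: ler_pM => //; rewrite ?mulr_ge0 ?powR_ge0 ?(ltW n0').
(* The exponent of b is gamma (1 - t) + (alpha + w) t - (alpha - w), which is
   w + w t - (1 - t) (alpha - gamma) = w t - 3 w, hence at most - 2 w. *)
rewrite -!powRD; try by rewrite (gt_eqF b0) implybT.
rewrite mulrC -ler_pdivlMr//.
apply: (@le_trans _ _ (b `^ (- (2 * w)))).
  rewrite ler_powR//.
  have : (1 - t) * (alpha - gamma) = 4 * w by rewrite /w; lra.
  have : 0 <= w * (1 - t) by rewrite mulr_ge0//; lra.
  nra.
near: b; apply: near_pinfty_powRN_le; first by rewrite mulr_gt0.
by rewrite divr_gt0.
Unshelve. all: end_near. Qed.

Lemma near_top_term (K t : R) : 0 < t -> t `^ (- alpha) < 1 + expR (- K) / 3 ->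
  \forall b \near +oo, forall n : nat, (0 < n)%N ->
  n%:R * (expR (K - ln (n%:R * T b)) * (T (t * b) - T b)) <= 3^-1.
Proof.
move=> t0 Ht; near=> b => n n0.
have n0' : 0 < n%:R :> R by rewrite ltr0n.
have H : T (t * b) / T b < 1 + expR (- K) / 3.
  by near: b; exact: (cvgr_lt _ (Trv t0)).
rewrite expRD [expR (- ln _)]expRN lnK ?posrE ?mulr_gt0//.
have e0 : expR K != 0 by rewrite gt_eqF// expR_gt0.
have Tn0 : T b != 0 by rewrite gt_eqF.
rewrite (_ : _ * _ = expR K * (T (t * b) / T b - 1)); last first.
  by field; rewrite Tn0 gt_eqF.
apply: (@le_trans _ _ (expR K * (expR (- K) / 3))).
  by rewrite ler_wpM2l ?expR_ge0//; lra.
by rewrite expRN mulrA mulfV// mul1r.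
Unshelve. all: end_near. Qed.

(** The cut [t < 1] is such that [t `^ (- alpha) = 1 + e] with [e] of order
    [expR (- K)], to compensate for the factor [expR K] of the part of the
    integral above [t * b]; then [q < alpha] is chosen close enough to [alpha],
    depending on [t], for the part below. *)
Lemma near_upper_tilt (K : R) : 0 <= K -> \forall b \near +oo,
  forall n : nat, (0 < n)%N -> n%:R <= b `^ gamma ->
  0 < theta F n b /\
  (\int[F]_x (\1_(`]-oo, b[%classic) x * expR ((theta F n b + K / b) * x))%:E <=
   (1 + n%:R^-1)%:E)%E.
Proof.
move=> K0; have a1' := a1; have ga' := ga.
pose e := expR (- K) / 6.
have e0 : 0 < e by rewrite divr_gt0 ?expR_gt0.
pose t := (1 + e) `^ (- alpha^-1).
have t0 : 0 < t by rewrite powR_gt0//; lra.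
have t1 : t < 1.
  rewrite -[ltRHS](powRr0 (1 + e)) /t /powR gt_eqF; last lra.
  rewrite ltr_expR ltr_pM2r ?ln_gt0//; last lra.
  by rewrite oppr_lt0 invr_gt0; lra.
have ta : t `^ (- alpha) < 1 + expR (- K) / 3.
  rewrite /t -powRrM mulrNN mulVf ?gt_eqF//; last lra.
  by rewrite powRr1; rewrite /e in e0 *; have := expR_gt0 (- K); lra.
pose w := (1 - t) * (alpha - gamma) / 4.
have w0 : 0 < w by rewrite divr_gt0// mulr_gt0//; lra.
pose q := Num.max 1 (alpha - w).
have q1 : 1 <= q by rewrite le_max lexx.
have qa : q < alpha by rewrite gt_max a1'; lra.
have wq : alpha - w <= q by rewrite le_max lexx orbT.
have [mq mq0 Hmq] := Hq q1 qa.
near=> b => n n0 nb.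
have b0 : 0 < b by [].
have n0' : 0 < n%:R :> R by rewrite ltr0n.
have c1 : n%:R * T b <= 2^-1.
  by move: n nb {n0 n0'}; near: b; exact: near_tail_small.
have th0 : 0 < theta F n b.
  rewrite /theta divr_gt0// oppr_gt0 ln_lt0// mulr_gt0//=; lra.
split => //.
have phi0 : 0 < theta F n b + K / b.
  by rewrite ltr_pwDl// divr_ge0// ltW.
have phib : theta F n b + K / b = (K - ln (n%:R * T b)) / b.
  by rewrite /theta; field; rewrite gt_eqF.
have tb0 : 0 < t * b by rewrite mulr_gt0.
have tb : t * b < b by rewrite gtr_pMl.
apply: (le_trans (upper_tilt_integral iF F0 p1 p2 q1 Hp Hmq phi0 tb0 tb)).
rewrite lee_fin lerD2l -[leRHS]mul1r ler_pdivlMr// mulrC phib.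
have hA : n%:R * (expR q * ((K - ln (n%:R * T b)) / b) `^ p * mp) <= 3^-1.
  by move: n n0 nb {n0' c1 th0 phi0 phib}; near: b; exact: near_bulk_term.
have hB : n%:R * ((t * b) `^ (- q) * expR ((K - ln (n%:R * T b)) * t) * mq) <= 3^-1.
  move: n n0 nb {n0' c1 th0 phi0 phib hA}; near: b.
  exact: near_middle_term.
have hC : n%:R * (expR (K - ln (n%:R * T b)) * (T (t * b) - T b)) <= 3^-1.
  move: n n0 {nb n0' c1 th0 phi0 phib hA hB}; near: b.
  exact: near_top_term.
set l := K - _ in hA hB hC *.
rewrite [l / b * (t * b)](_ : _ = l * t); last by field; rewrite gt_eqF.
rewrite divfK ?gt_eqF// mulrDr mulrDr.
lra.
Unshelve. all: end_near. Qed.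

End asymptotics.

(** * The variance of the combined estimator *)

Section variance.
Context d (T : measurableType d) (R : realType) (P : probability T R).

Lemma bounded_Lfun2 (Z : T -> R) (B : R) : measurable_fun setT Z ->
  (forall x, `|Z x| <= B) -> Z \in Lfun P 2%:E.
Proof.
move=> mZ ZB; rewrite inE/=; apply/andP; split; rewrite inE//=.
rewrite /finite_norm unlock poweR_lty//.
have mZ2 : measurable_fun setT (fun x => `|Z x| `^ 2).
  apply: (measurableT_comp (measurable_powR 2)).
  by apply: measurableT_comp => //; exact: normr_measurable.
apply: (@le_lt_trans _ _ (\int[P]_x (cst (B `^ 2)%:E x))%E).
  apply: ge0_le_integral => //=.
  - exact/measurable_EFinP.
  - move=> x _; rewrite lee_fin ge0_ler_powR ?nnegrE//.
    exact: le_trans (ZB x).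
by rewrite integral_cst//; apply: lte_mul_pinfty;
  rewrite ?lee_fin ?powR_ge0// (le_lt_trans (probability_le1 _ _)) ?ltry.
Qed.

Lemma variance_le_integral (Z : T -> R) (B c : R) : measurable_fun setT Z ->
  (forall x, `|Z x| <= B) ->
  ('V_P[Z] <= \int[P]_x ((Z x - c) ^+ 2)%:E)%E.
Proof.
move=> mZ ZB; have Z2 := bounded_Lfun2 mZ ZB.
have Zc2 : (Z \- cst c)%R \in Lfun P 2%:E.
  apply: (@bounded_Lfun2 _ (B + `|c|)) => [|x /=].
    exact: measurable_funB.
  by rewrite (le_trans (ler_normB _ _))// lerD2r.
rewrite -(varianceB_cst_r c Z2) varianceE//.
have -> : ('E_P[(Z \- cst c) ^+ 2] = \int[P]_x ((Z x - c) ^+ 2)%:E)%E.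
  by rewrite unlock.
have Efin : ('E_P[(Z \- cst c)])%E \is a fin_num.
  apply: expectation_fin_num; apply: Lfun_subset12 => //.
  exact: fin_num_measure.
rewrite leeBlDr ?fin_numX// ?leeDl// -(fineK Efin) -EFin_expe lee_fin.
exact: sqr_ge0.
Qed.

End variance.

(** The variance is at most the second moment about [c], and the square of
    [f x - c + g y] is at most twice the sum of the squares. *)
Lemma variance_product_sum_le d1 d2 (T1 : measurableType d1)
    (T2 : measurableType d2) (R : realType) (P1 : probability T1 R)
    (P2 : probability T2 R) (f : T1 -> R) (g : T2 -> R) (Bf Bg c : R) :
  measurable_fun setT f -> measurable_fun setT g ->
  (forall x, `|f x| <= Bf) -> (forall y, `|g y| <= Bg) ->
  ('V_(P1 \x P2)[(fun xy => f xy.1 + g xy.2)%R] <=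
   2%:E * (\int[P1]_x ((f x - c) ^+ 2)%:E + \int[P2]_y ((g y) ^+ 2)%:E))%E.
Proof.
move=> mf mg fB gB.
have mf1 : measurable_fun setT (fun xy : T1 * T2 => f xy.1).
  exact: measurableT_comp.
have mg2 : measurable_fun setT (fun xy : T1 * T2 => g xy.2).
  exact: measurableT_comp.
have mZ : measurable_fun setT (fun xy : T1 * T2 => f xy.1 + g xy.2).
  exact: measurable_funD.
have ZB (xy : T1 * T2) : `|f xy.1 + g xy.2| <= Bf + Bg.
  by rewrite (le_trans (ler_normD _ _))// lerD.
apply: (le_trans (variance_le_integral (P1 \x P2)%E c mZ ZB)).
have mfc : measurable_fun setT (fun x => (f x - c) ^+ 2).
  by apply: measurable_funX; exact: measurable_funB.
have mg' : measurable_fun setT (fun x => (g x) ^+ 2).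
  exact: measurable_funX.
have mfc1 : measurable_fun setT (fun xy : T1 * T2 => ((f xy.1 - c) ^+ 2)%:E).
  apply/measurable_EFinP.
  exact: (measurableT_comp mfc (@measurable_fst _ _ T1 T2)).
have mg'2 : measurable_fun setT (fun xy : T1 * T2 => ((g xy.2) ^+ 2)%:E).
  apply/measurable_EFinP.
  exact: (measurableT_comp mg' (@measurable_snd _ _ T1 T2)).
apply: (@le_trans _ _ (\int[P1 \x P2]_xy
    (2%:E * (((f xy.1 - c) ^+ 2)%:E + ((g xy.2) ^+ 2)%:E)))%E).
  apply: ge0_le_integral => //.
  - by move=> xy _; rewrite lee_fin sqr_ge0.
  - apply/measurable_EFinP; apply: measurable_funX.
    exact: measurable_funB.
  - by apply: measurable_funeM; exact: emeasurable_funD.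
  - move=> xy _; rewrite -EFinD -EFinM lee_fin.
    have := sqr_ge0 (f xy.1 - c - g xy.2).
    set u := f xy.1; set v := g xy.2; nra.
rewrite ge0_integralZl_EFin//; last 2 first.
- by move=> xy _; rewrite adde_ge0// lee_fin sqr_ge0.
- exact: emeasurable_funD.
rewrite lee_wpmul2l// ge0_integralD//; last 2 first.
- by move=> xy _; rewrite lee_fin sqr_ge0.
- by move=> xy _; rewrite lee_fin sqr_ge0.
rewrite fubini_tonelli1//; last by move=> xy; rewrite lee_fin sqr_ge0.
rewrite fubini_tonelli2//; last by move=> xy; rewrite lee_fin sqr_ge0.
rewrite /fubini_F /fubini_G /=.
have cstP d' (T' : measurableType d') (Q : probability T' R) (k : R) :
    (\int[Q]_x k%:E = k%:E)%E.
  rewrite -[in LHS](mul1r k) -[RHS]mule1 -(integral_one Q).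
  under eq_integral do rewrite mulrC EFinM.
  by rewrite integralZl//; exact: finite_measure_integrable_cst.
by under eq_integral do rewrite cstP; rewrite leeD2l//;
  under eq_integral do rewrite cstP.
Qed.

(** * The estimator of the dominant part *)

Section estimator_measurability.
Context {R : realType}.
Variables (F : probability R R) (n : nat) (b : R).

Lemma tuple_max_geP (x : n.-tuple R) :
  reflect (exists k, b <= tnth x k) (b%:E <= tuple_max x)%E.
Proof.
rewrite leNgt; apply: (iffP negP) => [H|[k bk] /bigmax_ltP[_ /(_ k isT)]].
  apply: contrapT => nk; apply: H; apply/bigmax_ltP; split; first exact: ltNyr.
  move=> k _; rewrite lte_fin ltNge; apply/negP => bk; apply: nk.
  by exists k.
by rewrite lte_fin ltNge bk.
Qed.

Lemma measurable_tuple_sum : measurable_fun setT (@tuple_sum R n).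
Proof. by apply: measurable_sum => k; exact: measurable_tnth. Qed.

Lemma measurable_tuple_sum_gt : measurable [set x : n.-tuple R | b < tuple_sum x].
Proof.
rewrite (_ : mkset _ = setT `&` @tuple_sum R n @^-1` `]b, +oo[%classic).
  by apply: measurable_tuple_sum => //; exact: measurable_itv.
by apply/seteqP; split=> x /=; rewrite in_itv/= andbT => // -[].
Qed.

Lemma measurable_tuple_max_ge :
  measurable [set x : n.-tuple R | (b%:E <= tuple_max x)%E].
Proof.
rewrite (_ : mkset _ = \bigcup_(k in [set: 'I_n])
   ((fun x : n.-tuple R => tnth x k) @^-1` `[b, +oo[%classic)).
  apply: fin_bigcup_measurable; first exact: finite_finset.
  move=> k _; rewrite -[X in measurable X]setTI.
  by apply: measurable_tnth => //; exact: measurable_itv.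
apply/seteqP; split => x /=.
  by move=> /tuple_max_geP[k bk]; exists k => //=; rewrite in_itv/= andbT.
move=> [k _ /=]; rewrite in_itv/= andbT => bk.
by apply/tuple_max_geP; exists k.
Qed.

Lemma measurable_A_dom : measurable (@A_dom R n b).
Proof.
exact: (measurableI _ _ measurable_tuple_sum_gt measurable_tuple_max_ge).
Qed.

Lemma measurable_A_res : measurable (@A_res R n b).
Proof.
rewrite (_ : A_res b = [set x : n.-tuple R | b < tuple_sum x] `&`
  ~` [set x : n.-tuple R | (b%:E <= tuple_max x)%E]).
  apply: measurableI; first exact: measurable_tuple_sum_gt.
  by apply: measurableC; exact: measurable_tuple_max_ge.
apply/seteqP; split => x /= -[H1 H2]; split => //.
  by apply/negP; rewrite -ltNge.
by move/negP: H2; rewrite -ltNge.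
Qed.

Lemma card_ge_sum (x : n.-tuple R) :
  #|[set k : 'I_n | b <= tnth x k]%SET|%:R =
  \sum_(k < n) \1_(`[b, +oo[%classic) (tnth x k) :> R.
Proof.
rewrite -sum1_card natr_sum big_mkcond/=; apply: eq_bigr => k _.
rewrite inE indicE; have -> : (tnth x k \in `[b, +oo[%classic) = (b <= tnth x k).
  by apply/idP/idP; rewrite inE /= in_itv/= andbT.
by case: (b <= _).
Qed.

Lemma measurable_Z_dom : measurable_fun setT (@Z_dom R F n b).
Proof.
(* The inverse of a nonnegative number is its power -1, a measurable function. *)
rewrite (_ : Z_dom F b = fun x : n.-tuple R => n%:R * tail F b *
  (\sum_(k < n) \1_(`[b, +oo[%classic) (tnth x k)) `^ (-1) * \1_(A_dom b) x).
  apply: measurable_funM; last by apply: measurable_indic; exact: measurable_A_dom.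
  apply: measurable_funM => //.
  apply: (measurableT_comp (measurable_powR (-1))).
  apply: measurable_sum => k; apply: measurableT_comp.
    by apply: measurable_indic; exact: measurable_itv.
  exact: measurable_tnth.
apply/funext => x; rewrite /Z_dom card_ge_sum powR_inv1//.
by apply: sumr_ge0.
Qed.

Lemma measurable_Z_res : measurable_fun setT (@Z_res R F n b).
Proof.
apply: measurable_funM; last by apply: measurable_indic; exact: measurable_A_res.
apply: measurableT_comp; first exact: measurable_expR.
apply: measurable_funD => //; apply: measurable_funM => //.
exact: measurable_tuple_sum.
Qed.

Lemma Z_dom_bounds (x : n.-tuple R) : 0 <= Z_dom F b x <= n%:R * tail F b.
Proof.
have c0 : 0 <= n%:R * tail F b by rewrite mulr_ge0// tail_ge0.
rewrite /Z_dom indicE; case: (boolP (x \in _)) => [|_]; last first.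
  by rewrite mulr0 lexx c0.
rewrite inE => -[_ /tuple_max_geP[k bk]]; rewrite mulr1.
have card0 : (0 < #|[set k : 'I_n | (b <= tnth x k)%R]%SET|)%N.
  by apply/card_gt0P; exists k; rewrite inE.
by rewrite divr_ge0//= ler_pdivrMr ?ltr0n// ler_peMr// ler1n.
Qed.

(** The estimator is exact on the event that is typical under [P1]. *)
Lemma Z_dom_one_big (x : n.-tuple R) (i : 'I_n) : b <= tnth x i ->
  (forall j, j != i -> tnth x j < b) -> b < tuple_sum x ->
  Z_dom F b x = n%:R * tail F b.
Proof.
move=> bi bj bS; rewrite /Z_dom indicE mem_set ?mulr1; last first.
  by split => //; apply/tuple_max_geP; exists i.
rewrite (_ : [set k : 'I_n | b <= tnth x k]%SET = [set i]%SET) ?cards1 ?divr1//.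
apply/setP => j; rewrite !inE; have [->|ji] := eqVneq j i; first by rewrite bi.
by apply/negbTE; rewrite -ltNge bj.
Qed.

End estimator_measurability.

(** The probability that an increment conditioned to be at least [b] is at most
    [u * b]; the bound is small for [b] large and [u], [t] close to [1].  As [F] may have an atom at [b], its mass from [b] on, included, is
    compared with the tail at [t * b] instead of [b]. *)
Lemma cond_ge_itv_le (R : realType) (F : probability R R) (b u t : R) :
  (forall x, 0 < tail F x) -> 0 < b -> 1 <= u -> t < 1 ->
  (cond_ge F b `]-oo, (u * b)%R]%classic <=
     (1 - tail F (u * b) / tail F (t * b))%:E)%E.
Proof.
move=> T0 b0 u1 t1.
have mI (i : interval R) : measurable [set` i] by exact: measurable_itv.
have fF (i : interval R) : F [set` i] \is a fin_num by exact: fin_num_measure.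
set G := fine (F `[b, +oo[%classic).
have Gge : tail F b <= G.
  rewrite /tail /G fine_le ?fin_num_measure// le_measure ?inE//.
  by move=> x /=; rewrite !in_itv/= !andbT => /ltW.
have G0 : 0 < G by exact: lt_le_trans Gge.
have GE : F `[b, +oo[%classic = G%:E by rewrite /G fineK.
have bu : b <= u * b by rewrite ler_peMl// ltW.
have Fbu : (F `[b, (u * b)%R]%classic = (G - tail F (u * b))%:E)%E.
  have : (F `[b, +oo[%classic = F `[b, (u * b)%R]%classic + F `](u * b)%R, +oo[%classic)%E.
    rewrite -measureU//.
      congr (F _); apply/seteqP; split => x /=; rewrite !in_itv/= !andbT.
        by move=> bx; rewrite bx /=; case: (leP x (u * b)); [left|right].
      by move=> [/andP[]//|]; move/ltW; exact: le_trans.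
    apply/seteqP; split => x //=; rewrite !in_itv/= andbT => -[/andP[_ h]].
    by rewrite ltNge h.
  rewrite GE EFinB /tail fineK// => ->.
  by rewrite (fineK (fF _)) addeK.
rewrite /cond_ge /= /mnormalize /= /mrestr setTI GE eqe gt_eqF//=.
rewrite (_ : _ `&` _ = `[b, (u * b)%R]%classic); last first.
  apply/seteqP; split => x /=; rewrite !in_itv/= ?andbT.
    by move=> [-> ->].
  by move=> /andP[-> ->].
rewrite Fbu -EFinM lee_fin mulrBl mulfV ?gt_eqF// lerD2l lerN2.
rewrite ler_wpM2l ?tail_ge0// lef_pV2 ?posrE//.
rewrite /G /tail fine_le ?fin_num_measure// le_measure ?inE//.
move=> x /=; rewrite !in_itv/= !andbT; apply: lt_le_trans.
by rewrite gtr_pMl.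
Qed.

Section dom_second_moment.
Context {R : realType}.
Variables (F : probability R R) (n : nat) (b : R).
Variables (a K D u kappa : R).
Hypotheses (b0 : 0 < b) (K0 : 0 <= K) (D1 : 1 <= D) (a0 : 0 <= a) (u1 : 1 <= u).
Hypothesis Ha : (F [set x | (b <= `|x|)%R] <= a%:E)%E.
Hypothesis HD :
  (\int[F]_x (\1_(`](- b)%R, +oo[%classic) x * expR (- (K / b) * x))%:E <= D%:E)%E.
Hypothesis Hkappa : (cond_ge F b `]-oo, (u * b)%R]%classic <= kappa%:E)%E.

Let c := n%:R * tail F b.
Let err := kappa + (n%:R * a + expR (- (K * (u - 1))) * D ^+ n).

(** The error given that the uniform index is [i]: [Z_dom] lies between [0] and
    [c], so it is at most [c ^+ 2] times the probability that they differ. *)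
Lemma dom_error_component (i : 'I_n) :
  (\int[product_law n (fun k => if k == i then cond_ge F b else F)]_x
     ((Z_dom F b x - c) ^+ 2)%:E <= (c ^+ 2 * err)%:E)%E.
Proof.
set Q := product_law _ _.
have fac := product_law_factorizes n (fun k => if k == i then cond_ge F b else F).
rewrite -/Q in fac.
pose bad := [set x : n.-tuple R | Z_dom F b x <> c].
have mbad : measurable bad.
  rewrite (_ : bad = setT `&` @Z_dom R F n b @^-1` (~` [set c])); last first.
    by rewrite setTI.
  by apply: measurable_Z_dom => //; exact: measurableC.
have c0 : 0 <= c by rewrite mulr_ge0// tail_ge0.
apply: (@le_trans _ _ (\int[Q]_x ((c ^+ 2)%:E * (\1_bad x)%:E))%E).
  apply: ge0_le_integral => //.
  - by move=> x _; rewrite lee_fin sqr_ge0.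
  - apply/measurable_EFinP; apply: measurable_funX.
    by apply: measurable_funB => //; exact: measurable_Z_dom.
  - by apply/measurable_EFinP; apply: measurable_funM.
  - move=> x _; rewrite -EFinM lee_fin indicE.
    case: (boolP (x \in bad)) => [_|].
      have /andP[z0 zc] := Z_dom_bounds F b x.
      by rewrite mulr1 -/c in zc *; nra.
    rewrite notin_setE => /contrapT ->.
    by rewrite subrr expr0n mulr0.
rewrite ge0_integralZl_EFin ?sqr_ge0//; last by apply/measurable_EFinP.
rewrite integral_indic// setIT [leRHS]EFinM lee_wpmul2l ?lee_fin ?sqr_ge0//.
have mu : measurable (`](u * b), +oo[%classic : set R) by exact: measurable_itv.
have ml : measurable (`]-oo, (u * b)]%classic : set R) by exact: measurable_itv.
pose E := bad `&` (fun x : n.-tuple R => tnth x i) @^-1` `](u * b), +oo[%classic.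
have mE : measurable E.
  by apply: measurableI => //; exact: (factorizes_preimage fac i mu).
pose E' := (fun x : n.-tuple R => tnth x i) @^-1` `]-oo, (u * b)]%classic.
have mE' : measurable E' by exact: (factorizes_preimage fac i ml).
apply: (@le_trans _ _ (Q (E' `|` E))).
  apply: le_measure; rewrite ?inE//; first exact: measurableU.
  move=> x badx; have [h|h] := leP (tnth x i) (u * b).
    by left; rewrite /E'/= in_itv.
  by right; split => //=; rewrite in_itv/= andbT.
apply: (le_trans (measureU2 _ mE' mE)).
rewrite EFinD; apply: leeD.
  by rewrite [leLHS](factorizes_marginal fac i ml)/= eqxx.
apply: (@le_trans _ _ ((if (i : nat) == i then cond_ge F b else F) `](u * b)%R, +oo[%classic *
  (n%:R * a + expR (- (K * (u - 1))) * D ^+ n)%:E)%E).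
  apply: (sum_others_lower_tail fac mu mE (b := b)) => //.
  - move=> x [badx xi]; split => //.
    have [|nV] := pselect (exists2 j, j != i & b <= `|tnth x j|); first by right.
    left; rewrite leNgt; apply/negP => H; apply: badx.
    move: xi; rewrite /= in_itv/= andbT => xi.
    apply: (@Z_dom_one_big _ _ _ _ _ i).
    + by rewrite (le_trans _ (ltW xi))// ler_peMl// ltW.
    + move=> j ji; rewrite ltNge; apply/negP => bj; apply: nV; exists j => //.
      exact: le_trans bj (ler_norm _).
    + by rewrite /tuple_sum (bigD1 i)//=; lra.
  - by move=> j ji; rewrite ifN.
  - by move=> j ji; rewrite ifN.
rewrite eqxx -[leRHS]mul1e lee_wpmul2r ?lee_fin//.
  by rewrite addr_ge0// mulr_ge0 ?expR_ge0 ?exprn_ge0// (le_trans ler01).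
exact: probability_le1.
Qed.

Lemma dom_error : (0 < n)%N ->
  (\int[P1 F n b]_x ((Z_dom F b x - c) ^+ 2)%:E <= (c ^+ 2 * err)%:E)%E.
Proof.
move=> n0.
have mf : measurable_fun setT (fun x : n.-tuple R => ((Z_dom F b x - c) ^+ 2)%:E).
  apply/measurable_EFinP; apply: measurable_funX.
  by apply: measurable_funB => //; exact: measurable_Z_dom.
have f0 (x : n.-tuple R) : (0 <= ((Z_dom F b x - c) ^+ 2)%:E)%E.
  by rewrite lee_fin sqr_ge0.
rewrite (eq_measure_integral (mixture F n b)); last first.
  by move=> A mA _; exact: (as_probabilityE A (mixture_setT F b n0)).
rewrite /mixture ge0_integral_mscale// ge0_integral_measure_sum//=.
have n0' : 0 < n%:R :> R by rewrite ltr0n.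
apply: (@le_trans _ _ ((n%:R^-1)%:E * \sum_(i < n) (c ^+ 2 * err)%:E)%E).
  rewrite lee_wpmul2l ?lee_fin ?invr_ge0//.
  by apply: lee_sum => i _; exact: dom_error_component.
rewrite sumEFin -EFinM lee_fin sumr_const card_ord -[X in _ * X <= _]mulr_natl mulrA.
by rewrite mulVf ?mul1r// gt_eqF.
Qed.

End dom_second_moment.

(** * The estimator of the residual part *)

Section res_second_moment.
Context {R : realType}.
Variables (F : probability R R) (n : nat) (b K D : R).
Hypotheses (b0 : 0 < b) (n0 : (0 < n)%N) (T0 : 0 < tail F b) (K0 : 0 <= K)
  (D1 : 1 <= D).
Let th := theta F n b.
Let c := n%:R * tail F b.
Hypotheses (th0 : 0 <= th) (Fb : (0 < F `]-oo, b[%classic)%E).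
Hypothesis HM :
  (\int[F]_x (\1_(`]-oo, b[%classic) x * expR (th * x))%:E <= D%:E)%E.
Hypothesis HMK :
  (\int[F]_x (\1_(`]-oo, b[%classic) x * expR ((th + K / b) * x))%:E <= D%:E)%E.

Lemma expR_theta : expR (- (th * b)) = c.
Proof.
rewrite /th /theta divfK ?gt_eqF// opprK lnK// posrE mulr_gt0//.
by rewrite ltr0n.
Qed.

(** If the integral defining [Lambda] vanished, [Lambda] would be [0] because
    [ln 0 = 0], and the bound would follow from [1 <= D]. *)
Lemma expR_Lambda_le : expR (Lambda F b th) <= D.
Proof.
rewrite /Lambda; set M := (\int[F]_(x in _) _)%R.
have [M0|M0] := leP M 0; first by rewrite ln0// expR0.
rewrite lnK// -lee_fin; apply: le_trans HM.
rewrite /M /Rintegral fineK.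
  rewrite integral_mkcond le_eqVlt; apply/orP; left; apply/eqP.
  apply: eq_integral => x _; rewrite patchE indicE.
  by case: ifP => _; rewrite ?mul1r ?mul0r.
rewrite ge0_fin_numE; last by apply: integral_ge0 => x _; rewrite lee_fin expR_ge0.
apply: le_lt_trans (ltry D); apply: le_trans HM.
rewrite integral_mkcond le_eqVlt; apply/orP; left; apply/eqP.
apply: eq_integral => x _; rewrite patchE indicE.
by case: ifP => _; rewrite ?mul1r ?mul0r.
Qed.

Lemma integral_tilted (g : R -> R) : measurable_fun setT g -> (forall x, 0 <= g x) ->
  (\int[as_probability (tilted F b th)]_x (g x)%:E =
   \int[F]_x (tilt_density F b th x * g x)%:E)%E.
Proof.
move=> mg g0.
have td0 x : 0 <= tilt_density F b th x by exact: tilt_density_ge0.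
apply: esym; rewrite -[RHS]mul1e.
apply: (@weighted_integral_transfer _ _ _ _ _ F
   (as_probability (tilted F b th)) _ idfun 1) => //.
- exact: measurable_tilt_density.
- exact: measurable_id.
move=> B mB; rewrite mul1e.
rewrite [RHS](as_probabilityE B (tilted_setT th0 Fb)) /= /tilted [RHS]integral_mkcond; apply: eq_integral => x _.
rewrite patchE indicE; case: (boolP (x \in B)) => _; first by rewrite mulr1.
by rewrite mulr0.
Qed.

Lemma integral_tilted_expR :
  (\int[as_probability (tilted F b th)]_x (expR (K / b * x))%:E <=
   (expR (- Lambda F b th) * D)%:E)%E.
Proof.
have me (k : R) : measurable_fun setT (fun x : R => expR (k * x)).
  apply: measurableT_comp; first exact: measurable_expR.
  exact: mulrl_measurable.
rewrite integral_tilted//.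
rewrite (_ : integral _ _ _ = \int[F]_x ((expR (- Lambda F b th))%:E *
    (\1_(`]-oo, b[%classic) x * expR ((th + K / b) * x))%:E))%E; last first.
  apply: eq_integral => x _; rewrite -EFinM; congr EFin.
  rewrite /tilt_density [th * x - _]addrC expRD mulrDl expRD; ring.
rewrite ge0_integralZl_EFin ?expR_ge0//; last first.
  by apply/measurable_EFinP; apply: measurable_funM => //; exact: measurable_indic.
by rewrite [leRHS]EFinM lee_wpmul2l// lee_fin expR_ge0.
Qed.

Lemma Z_res_bounds (x : n.-tuple R) :
  0 <= Z_res F b x <= expR (- (th * b) + n%:R * Lambda F b th).
Proof.
rewrite /Z_res -/th indicE; case: (boolP (x \in _)) => [|_]; last first.
  by rewrite mulr0 lexx expR_ge0.
rewrite inE => -[bS _]; rewrite mulr1 expR_ge0/= ler_expR lerD2r mulNr lerN2.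
by rewrite ler_wpM2l// ltW.
Qed.

(** On [A_res] the sum exceeds [b], so that
    [expR (K / b * (tuple_sum x - b))] is at least [1]; inserting it
    tilts the law by [K / b] more and gains the factor [expR (- K)]. *)
Lemma res_second_moment :
  (\int[P2 F n b]_x ((Z_res F b x) ^+ 2)%:E <=
   (c ^+ 2 * (expR (- K) * (D ^+ n * D ^+ n)))%:E)%E.
Proof.
set La := Lambda F b th.
pose C := expR (2 * (n%:R * La) - 2 * (th * b) - K).
have me (k : R) : measurable_fun setT (fun x : R => expR (k * x)).
  apply: measurableT_comp; first exact: measurable_expR.
  exact: mulrl_measurable.
have mprod : measurable_fun setT
    (fun x : n.-tuple R => \prod_(k < n) expR (K / b * tnth x k)).
  exact: (@measurable_prod_tnth _ _ _ n (fun _ x => expR (K / b * x))).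
have prod0 (x : n.-tuple R) : 0 <= \prod_(k < n) expR (K / b * tnth x k).
  by apply: prodr_ge0 => k _; exact: expR_ge0.
apply: (@le_trans _ _ (\int[P2 F n b]_x
   (C%:E * (\prod_(k < n) expR (K / b * tnth x k))%:E))%E).
  apply: ge0_le_integral => //.
  - by move=> x _; rewrite lee_fin sqr_ge0.
  - apply/measurable_EFinP; apply: measurable_funX; exact: measurable_Z_res.
  - by apply/measurable_EFinP; apply: measurable_funM.
  - move=> x _; rewrite -EFinM lee_fin /Z_res -/th -/La indicE.
    case: (boolP (x \in _)) => [|_]; last first.
      by rewrite mulr0 expr0n/= mulr_ge0// expR_ge0.
    rewrite inE => -[bS _]; rewrite mulr1 -expR_sum -mulr_sumr.
    rewrite expr2 -!expRD ler_expR -/(tuple_sum x).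
    have h1 : th * b <= th * tuple_sum x by rewrite ler_wpM2l// ltW.
    have h2 : K / b * b <= K / b * tuple_sum x.
      by rewrite ler_wpM2l ?divr_ge0 ?(ltW b0)// ltW.
    by rewrite divfK ?gt_eqF// in h2; rewrite mulNr; lra.
rewrite ge0_integralZl_EFin ?expR_ge0//; last 2 first.
- by move=> x _; rewrite lee_fin.
- exact/measurable_EFinP.
rewrite /P2 (@integral_product_law _ _ _ n _ (fun _ x => expR (K / b * x)))//.
have ntD : (\int[as_probability (tilted F b th)]_x (expR (K / b * x))%:E
    \is a fin_num)%E.
  rewrite ge0_fin_numE; last by apply: integral_ge0 => x _; rewrite lee_fin expR_ge0.
  exact: le_lt_trans integral_tilted_expR (ltry _).
rewrite -/th -(fineK ntD) prodEFin -EFinM lee_fin prodr_const card_ord.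
set I := fine _.
have ID : I <= expR (- La) * D by rewrite -lee_fin fineK// integral_tilted_expR.
have I0 : 0 <= I.
  by rewrite fine_ge0// integral_ge0// => x _; rewrite lee_fin expR_ge0.
apply: (@le_trans _ _ (C * (expR (- La) * D) ^+ n)).
  rewrite ler_wpM2l ?expR_ge0// lerXn2r ?nnegrE//.
  exact: le_trans I0 ID.
have CE : C * (expR (- La) * D) ^+ n = c ^+ 2 * (expR (- K) * (expR La ^+ n * D ^+ n)).
  have E1 : C * expR (n%:R * - La) = c ^+ 2 * expR (- K) * expR (n%:R * La).
    by rewrite -expR_theta expr2 -!expRD; congr expR; ring.
  by rewrite exprMn -!expRM_natl [LHS]mulrA E1 -!mulrA.
rewrite CE ler_wpM2l ?sqr_ge0// ler_wpM2l ?expR_ge0// ler_wpM2r//.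
  by rewrite exprn_ge0// (le_trans ler01).
rewrite lerXn2r ?nnegrE ?expR_ge0 ?(le_trans ler01)//.
exact: expR_Lambda_le.
Qed.

End res_second_moment.

(** * Relative variance, uniformly in the regime *)

Section relative_variance.
Context {R : realType}.
Variables (F : probability R R) (alpha gamma p mp : R).
Hypotheses (iF : F.-integrable setT (EFin : R -> \bar R))
  (F0 : (\int[F]_x x%:E = 0)%E).
Hypotheses (p1 : 1 <= p) (p2 : p <= 2) (ga : gamma < alpha)
  (gp : gamma < p) (a1 : 1 < alpha) (mp0 : 0 < mp).
Hypothesis Hp : (\int[F]_x (`|x| `^ p)%:E <= mp%:E)%E.
Hypothesis Hq : forall q, 1 <= q -> q < alpha ->
  exists2 mq : R, 0 <= mq & (\int[F]_x ((Num.max x 0) `^ q)%:E <= mq%:E)%E.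
Hypothesis T0 : forall x, 0 < tail F x.
Hypothesis Trv : regularly_varying alpha (tail F).

Local Notation T := (tail F).

Lemma near_sum_upper_tail : \forall b \near +oo, forall n : nat, (0 < n)%N ->
  n%:R <= b `^ gamma ->
  forall d' (T' : measurableType d') (P : probability T' R) (Y : 'I_n -> T' -> R),
  factorizes P Y (fun=> F) ->
  ((2 `^ (- alpha) / 4 * (n%:R * T b))%:E <=
     P [set w | (b < \sum_(j < n) Y j w)%R])%E.
Proof.
have i4 : 0 < (4^-1 : R) / mp by rewrite divr_gt0.
near=> b => n n0 nb d' T' P Y fac.
have b0 : 0 < b by [].
have n0' : 0 < n%:R :> R by rewrite ltr0n.
have na : n%:R * (b `^ (- p) * mp) <= 4^-1.
  rewrite mulrA -ler_pdivlMr//; move: n nb {n0 n0' Y fac}; near: b.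
  exact: (near_moment_rate gp).
have H := @sum_upper_tail_ge _ _ _ P n Y (fun=> F) fac (T (2 * b)) b
  (b `^ (- p) * mp) 3 (1 + n%:R^-1).
have TE : F `]2 * b, +oo[%classic = (T (2 * b))%:E.
  by rewrite /tail fineK// fin_num_measure.
have HD : (\int[F]_x (\1_(`](- b)%R, +oo[%classic) x * expR (- (3 / b) * x))%:E
    <= (1 + n%:R^-1)%:E)%E.
  move: n n0 nb {n0' Y fac na H TE}; near: b.
  by apply: (near_lower_tilt iF F0 p1 p2 gp mp0 Hp); lra.
have {}H := H (fun=> TE) b0 (ler0n _ 3) (@ler1_one_plus_inv R n).
have {H}H := H (mulr_ge0 (powR_ge0 _ _) (ltW mp0)) (fun=> markov_abs p1 Hp b0) (fun=> HD).
apply: le_trans H; rewrite lee_fin.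
have T2 : 2 `^ (- alpha) / 2 <= T (2 * b) / T b.
  apply: ltW; near: b; apply: (cvgr_gt _ (Trv _)) => //.
  by rewrite ltr_pdivrMr// ltr_pMr ?powR_gt0// ltr1n.
have eD : expR (- 3) * (1 + n%:R^-1) ^+ n <= 4^-1 :> R.
  apply: (@le_trans _ _ (expR (- 3) * expR 1)).
    by rewrite ler_wpM2l ?expR_ge0// expr_one_plus_inv_le.
  rewrite -expRD (_ : - 3 + 1 = - (1 + 1) :> R); last lra.
  rewrite expRN lef_pV2 ?posrE ?expR_gt0// expRD.
  by have := @expR_ge1Dx R 1; nra.
have TT : 2 `^ (- alpha) / 2 * T b <= T (2 * b) by rewrite -ler_pdivlMr.
have T20 := T0 (2 * b).
set z := expR (- 3) * _ in eD *; set y := n%:R * (_ * _) in na *.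
have -> : 2 `^ (- alpha) / 4 * (n%:R * T b) =
   n%:R * (2 `^ (- alpha) / 2 * T b * 2^-1) by field.
rewrite ler_wpM2l// ler_pM ?mulr_ge0 ?powR_ge0 ?(ltW (T0 b))//; lra.
Unshelve. all: end_near. Qed.

Lemma near_dom_error (e : R) : 0 < e -> \forall b \near +oo,
  forall n : nat, (0 < n)%N -> n%:R <= b `^ gamma ->
  (\int[P1 F n b]_x ((Z_dom F b x - n%:R * T b) ^+ 2)%:E <=
    ((n%:R * T b) ^+ 2 * e)%:E)%E.
Proof.
move=> e0; have a1' := a1.
pose h := Num.min (e / 16) 4^-1.
have h0 : 0 < h by rewrite lt_min divr_gt0//=.
have h4 : h <= 4^-1 by rewrite ge_min lexx orbT.
have he : 16 * h <= e by rewrite mulrC -ler_pdivlMr// ge_min lexx.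
pose u := (1 + h) `^ alpha^-1.
have u1 : 1 < u.
  rewrite -[ltLHS](powRr0 (1 + h)) /u /powR gt_eqF; last lra.
  by rewrite ltr_expR ltr_pM2r ?ln_gt0 ?invr_gt0//; lra.
have u0 : 0 < u by lra.
have uV0 : 0 < u^-1 by rewrite invr_gt0.
have uV1 : u^-1 < 1 by rewrite invf_lt1.
have uaV : u^-1 `^ (- alpha) < 1 + 2 * h.
  rewrite -(powR_inv1 (ltW u0)) /u -!powRrM.
  rewrite [X in _ `^ X](_ : _ = 1); first by rewrite powRr1; lra.
  by field; rewrite gt_eqF//; lra.
have ua : 1 - 2 * h < u `^ (- alpha).
  rewrite /u -powRrM [X in _ `^ X](_ : _ = -1); last first.
    by field; rewrite gt_eqF//; lra.
  rewrite powR_inv1; last lra.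
  rewrite -[ltRHS]mul1r ltr_pdivlMr; last lra.
  nra.
pose K := Num.max 1 ((1 - ln (e / 4)) / (u - 1)).
have K1 : 1 <= K by rewrite le_max lexx.
have Ku : expR (- (K * (u - 1))) * expR 1 <= e / 4.
  rewrite -expRD -[leRHS]lnK ?posrE ?divr_gt0// ler_expR.
  have : 1 - ln (e / 4) <= K * (u - 1).
    by rewrite -ler_pdivrMr ?subr_gt0// le_max lexx orbT.
  lra.
have i4 : 0 < (e / 4) / mp by rewrite !divr_gt0.
near=> b => n n0 nb.
have b0 : 0 < b by [].
have na : n%:R * (b `^ (- p) * mp) <= e / 4.
  rewrite mulrA -ler_pdivlMr//; move: n nb {n0}; near: b.
  exact: (near_moment_rate gp).
have HD : (\int[F]_x (\1_(`](- b)%R, +oo[%classic) x * expR (- (K / b) * x))%:E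
    <= (1 + n%:R^-1)%:E)%E.
  move: n n0 nb {na}; near: b.
  exact: (near_lower_tilt iF F0 p1 p2 gp mp0 Hp).
have Tu : 1 - 2 * h < T (u * b) / T b.
  by near: b; exact: (cvgr_gt _ (Trv u0)).
have Tt : T (u^-1 * b) / T b < 1 + 2 * h.
  by near: b; exact: (cvgr_lt _ (Trv uV0)).
(* The ratio T (u b) / T (b / u) tends to (1 + h)^(- 2); 16 h <= e leaves room
   for e / 2. *)
have kap : (cond_ge F b `]-oo, (u * b)%R]%classic <= (e / 2)%:E)%E.
  apply: (le_trans (cond_ge_itv_le T0 b0 (ltW u1) uV1)); rewrite lee_fin.
  move: Tu Tt; rewrite ltr_pdivlMr// ltr_pdivrMr// => Tu Tt.
  have Tb0 := T0 b.
  have Ttb := T0 (u^-1 * b).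
  rewrite lerBlDr -lerBlDl ler_pdivlMr//.
  have : (1 - e / 2) * T (u^-1 * b) <= (1 - 8 * h) * T (u^-1 * b).
    by rewrite ler_pM2r//; lra.
  have : (1 - 8 * h) * T (u^-1 * b) <= (1 - 2 * h) * T b.
    have [hh|hh] := leP 0 (1 - 8 * h); last first.
      by apply: (@le_trans _ _ 0); rewrite ?mulr_ge0 ?mulr_le0_ge0//; nra.
    have : (1 - 8 * h) * T (u^-1 * b) <= (1 - 8 * h) * ((1 + 2 * h) * T b).
      by rewrite ler_wpM2l// ltW.
    have : (1 - 8 * h) * (1 + 2 * h) <= 1 - 2 * h by nra.
    move=> /(ler_wpM2r (ltW Tb0)); lra.
  lra.
have K0 : 0 <= K by lra.
have a0 : 0 <= b `^ (- p) * mp by rewrite mulr_ge0 ?powR_ge0 ?ltW.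
have := dom_error b0 K0 (@ler1_one_plus_inv R n) a0 (ltW u1) (markov_abs p1 Hp b0) HD kap n0.
move=> /le_trans; apply; rewrite lee_fin ler_wpM2l ?sqr_ge0//.
have : expR (- (K * (u - 1))) * (1 + n%:R^-1) ^+ n <= expR (- (K * (u - 1))) * expR 1.
  by rewrite ler_wpM2l ?expR_ge0// expr_one_plus_inv_le.
lra.
Unshelve. all: end_near. Qed.

Lemma near_res_second_moment (e : R) : 0 < e -> \forall b \near +oo,
  forall n : nat, (0 < n)%N -> n%:R <= b `^ gamma ->
  (exists B : R, forall x : n.-tuple R, `|Z_res F b x| <= B) /\
  (\int[P2 F n b]_x ((Z_res F b x) ^+ 2)%:E <= ((n%:R * T b) ^+ 2 * e)%:E)%E.
Proof.
move=> e0; pose K := Num.max 0 (2 - ln e).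
have K0 : 0 <= K by rewrite le_max lexx.
have Ke : expR (- K) * (expR 1 * expR 1) <= e.
  rewrite -!expRD -[leRHS]lnK ?posrE// ler_expR.
  have : 2 - ln e <= K by rewrite le_max lexx orbT.
  lra.
have i4 : 0 < (2^-1 : R) / mp by rewrite !divr_gt0.
near=> b => n n0 nb.
have b0 : 0 < b by [].
have na : n%:R * (b `^ (- p) * mp) <= 2^-1.
  rewrite mulrA -ler_pdivlMr//; move: n nb {n0}; near: b.
  exact: (near_moment_rate gp).
have [th0 HK] : 0 < theta F n b /\
  (\int[F]_x (\1_(`]-oo, b[%classic) x * expR ((theta F n b + K / b) * x))%:E <=
   (1 + n%:R^-1)%:E)%E.
  move: n n0 nb {na}; near: b.
  exact: (near_upper_tilt iF F0 p1 p2 ga gp a1 mp0 Hp Hq T0 Trv).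
have [_ H0] : 0 < theta F n b /\
  (\int[F]_x (\1_(`]-oo, b[%classic) x * expR ((theta F n b + 0 / b) * x))%:E <=
   (1 + n%:R^-1)%:E)%E.
  move: n n0 nb {na th0 HK}; near: b.
  exact: (near_upper_tilt iF F0 p1 p2 ga gp a1 mp0 Hp Hq T0 Trv).
move: H0; rewrite mul0r addr0 => H0.
have Fb : (0 < F `]-oo, b[%classic)%E.
  have mI (i : interval R) : measurable [set` i] by exact: measurable_itv.
  have Fge : (F `[b, +oo[%classic <= 2^-1%:E)%E.
    apply: (@le_trans _ _ (F [set x | (b <= `|x|)%R])).
      apply: le_measure; rewrite ?inE//; first exact: measurable_norm_ge.
      by move=> x /=; rewrite in_itv/= andbT => bx; exact: le_trans bx (ler_norm _).
    apply: (le_trans (markov_abs p1 Hp b0)); rewrite lee_fin; apply: le_trans na.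
    by rewrite ler_peMl ?mulr_ge0 ?powR_ge0 ?(ltW mp0)// ler1n.
  have -> : `]-oo, b[%classic = ~` `[b, +oo[%classic by rewrite setCitvr.
  rewrite probability_setC// sube_gt0; apply: (le_lt_trans Fge).
  by rewrite lte_fin; lra.
split.
  exists (expR (- (theta F n b * b) + n%:R * Lambda F b (theta F n b))) => x.
  have /andP[z0 zb] := Z_res_bounds (ltW th0) x.
  by rewrite ger0_norm.
have := res_second_moment b0 n0 (T0 b) K0 (@ler1_one_plus_inv R n) (ltW th0) Fb H0 HK.
move=> /le_trans; apply; rewrite lee_fin ler_wpM2l ?sqr_ge0//.
apply: le_trans Ke; rewrite ler_wpM2l ?expR_ge0//.
by rewrite ler_pM ?exprn_ge0 ?expr_one_plus_inv_le// (le_trans ler01 (@ler1_one_plus_inv R n)).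
Unshelve. all: end_near. Qed.

Lemma near_relative_variance (e : R) : 0 < e -> \forall b \near +oo,
  forall n : nat, (0 < n)%N -> n%:R <= b `^ gamma ->
  forall d' (T' : measurableType d') (P : probability T' R) (Y : 'I_n -> T' -> R),
  factorizes P Y (fun=> F) ->
  (Var_Z F n b / P [set w | (b < \sum_(j < n) Y j w)%R] ^+ 2 <= e%:E)%E.
Proof.
move=> e0; pose k : R := 2 `^ (- alpha) / 4.
have k0 : 0 < k by rewrite divr_gt0// powR_gt0.
(* The variance is at most 4 c^2 e', and the probability at least k c. *)
pose e' := e * k ^+ 2 / 4.
have e'0 : 0 < e' by rewrite divr_gt0// mulr_gt0// exprn_gt0.
near=> b => n n0 nb d' T' P Y fac.
have Hd : (\int[P1 F n b]_x ((Z_dom F b x - n%:R * T b) ^+ 2)%:E <=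
    ((n%:R * T b) ^+ 2 * e')%:E)%E.
  by move: n n0 nb {Y fac}; near: b; exact: near_dom_error.
have [[B ZB] Hr] : (exists B : R, forall x : n.-tuple R, `|Z_res F b x| <= B) /\
  (\int[P2 F n b]_x ((Z_res F b x) ^+ 2)%:E <= ((n%:R * T b) ^+ 2 * e')%:E)%E.
  by move: n n0 nb {Y fac Hd}; near: b; exact: near_res_second_moment.
have HP : ((k * (n%:R * T b))%:E <= P [set w | (b < \sum_(j < n) Y j w)%R])%E.
  by move: n n0 nb d' T' P Y fac {Hd B ZB Hr}; near: b; exact: near_sum_upper_tail.
have c0 : 0 < n%:R * T b by rewrite mulr_gt0 ?ltr0n.
set c := n%:R * T b in Hd Hr HP c0 *.
set E := [set w | _] in HP *.
have mE : measurable E.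
  have [mY _] := fac.
  rewrite -[X in measurable X]setTI
    (_ : E = (fun w => \sum_(j < n) Y j w) @^-1` `]b, +oo[).
    by apply: measurable_sum => //; exact: measurable_itv.
  by apply/seteqP; split=> w /=; rewrite in_itv/= andbT.
have fE : P E \is a fin_num by exact: fin_num_measure.
move: HP; rewrite -(fineK fE) lee_fin => HP.
set r := fine (P E) in HP *.
have r0 : 0 < r by apply: lt_le_trans HP; rewrite mulr_gt0.
rewrite -EFin_expe inver gt_eqF ?exprn_gt0// lee_pdivrMr ?exprn_gt0//.
have Zd (x : n.-tuple R) : `|Z_dom F b x| <= c.
  by have /andP[z0 zc] := Z_dom_bounds F b x; rewrite ger0_norm.
have := @variance_product_sum_le _ _ _ _ _ (P1 F n b) (P2 F n b) _ _ _ _ c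
  (@measurable_Z_dom R F n b) (@measurable_Z_res R F n b) Zd ZB.
move=> /le_trans; apply.
apply: (@le_trans _ _ (2%:E * ((c ^+ 2 * e')%:E + (c ^+ 2 * e')%:E))%E).
  by rewrite lee_wpmul2l// leeD.
rewrite -EFinD -!EFinM lee_fin.
have : (k * c) ^+ 2 <= r ^+ 2.
  by rewrite lerXn2r ?nnegrE ?(ltW r0)// mulr_ge0 ?ltW.
move=> /(ler_wpM2l (ltW e0)); rewrite exprMn /e'; lra.
Unshelve. all: end_near. Qed.

End relative_variance.

(** * Vanishing relative error *)

Lemma limf_esup_lt_near (R : realType) (f : R -> \bar R) :
  (limf_esup f +oo%R < +oo)%E ->
  exists2 C : R, 0 <= C & \forall x \near +oo, (f x <= C%:E)%E.
Proof.
move=> /ereal_inf_lt[y [V FV <-]] supV.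
exists (Num.max 0 (fine (ereal_sup (f @` V)))); first by rewrite le_max lexx.
near=> x; have Vx : V x by near: x; exact: FV.
have fx : (f x <= ereal_sup (f @` V))%E by apply: ereal_sup_ubound; exists x.
move: supV fx; case: (ereal_sup _) => [r|//|] /=.
  by move=> _ /le_trans; apply; rewrite lee_fin le_max lexx orbT.
by move=> _; rewrite leeNy_eq => /eqP ->; rewrite leNye.
Unshelve. all: end_near. Qed.

Lemma cvg_ereal0 (R : realType) (u : nat -> \bar R) :
  (forall e : R, 0 < e -> \forall n \near \oo, (0 <= u n <= e%:E)%E) ->
  u n @[n --> \oo] --> 0%E.
Proof.
move=> H; apply/fine_cvgP; split.
  near=> n; have /andP[u0 u1] : (0 <= u n <= 1%:E)%E by near: n; exact: H.
  by rewrite ge0_fin_numE// (le_lt_trans u1)// ltry.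
apply/cvgr0Pnorm_le => e e0; near=> n.
have /andP[u0 u1] : (0 <= u n <= e%:E)%E by near: n; exact: H.
have uf : u n \is a fin_num by rewrite ge0_fin_numE// (le_lt_trans u1)// ltry.
by rewrite /= ger0_norm ?fine_ge0// -lee_fin fineK.
Unshelve. all: end_near. Qed.

Lemma near_nat_powR_ge (R : realType) (s M : R) : 0 < s ->
  \forall n \near \oo, M <= n%:R `^ s.
Proof. by move=> s0; exact: (cvgr_idn (near_pinfty_powR_ge M s0)). Qed.

Theorem theorem1 (R : realType) (d : measure_display) (T : measurableType d)
  (P : probability T R) (X : nat -> {RV P >-> R})
  (alpha epsilon : R) (L : R -> R)
  (X_iid : iid X)
  (X_integrable : P.-integrable setT (EFin \o X 0%N))
  (X_centered : ('E_P[X 0%N] = 0)%E)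
  (alpha_gt1 : 1 < alpha)
  (L_slowly_varying : slowly_varying L)
  (tailE : forall x : R, 0 < x ->
     tail (distribution P (X 0%N)) x = x `^ (- alpha) * L x)
  (left_tail : ('V_P[X 0%N] = +oo)%E ->
     (limf_esup (fun x : R => P [set w | (X 0%N w < - x)%R] /
                              P [set w | (x < X 0%N w)%R]) +oo%R < +oo)%E)
  (epsilon_gt0 : 0 < epsilon) :
  let F := distribution P (X 0%N) in
  let beta := (Num.min alpha 2)^-1 in
  ereal_sup [set (Var_Z F n b / P [set w | (b < partial_sum X n w)%R] ^+ 2)%E |
             b in [set b : R | n%:R `^ (beta + epsilon) < b]]
    @[n --> \oo] --> 0%E.
Proof.
move=> F beta.
pose m := Num.min alpha 2.
have m1 : 1 < m by rewrite lt_min alpha_gt1 ltr1n.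
have ma : m <= alpha by rewrite ge_min lexx.
have m2 : m <= 2 by rewrite ge_min lexx orbT.
have m0 : 0 < m by lra.
have be0 : 0 < beta + epsilon by rewrite addr_gt0// /beta invr_gt0.
pose gamma := (beta + epsilon)^-1.
have gm : gamma < m.
  rewrite /gamma invf_plt ?posrE//; by rewrite /beta -/m ltrDl.
have T0 := tail_gt0 L_slowly_varying tailE.
have Trv := tail_regularly_varying L_slowly_varying tailE.
have mX : measurable_fun setT (X 0%N) by [].
have iF : F.-integrable setT (EFin : R -> \bar R).
  by apply/integrable_pushforward => //; rewrite preimage_setT.
have F0 : (\int[F]_x x%:E = 0)%E.
  by rewrite integral_distribution// -X_centered unlock.
have [p [mp [p1 p2 gp mp0 Hp]]] : exists p mp : R, [/\ 1 <= p, p <= 2,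
    gamma < p, 0 < mp & (\int[F]_x (`|x| `^ p)%:E <= mp%:E)%E].
  (* With infinite variance, p lies between max(gamma, 1) and min(alpha, 2);
     with finite variance p = 2 > gamma, whatever alpha is. *)
  have [Vy|Vy] := eqVneq ('V_P[X 0%N])%E +oo%E.
    have [C C0 HC] := limf_esup_lt_near (left_tail Vy).
    pose p := (Num.max gamma 1 + m) / 2.
    have gm1 : Num.max gamma 1 < m by rewrite gt_max gm.
    have g1 : 1 <= Num.max gamma 1 by rewrite le_max lexx orbT.
    have gg : gamma <= Num.max gamma 1 by rewrite le_max lexx.
    have [|||mp mp0 Hp] := @abs_moment_finite R F alpha p C T0 Trv _ _ C0 _.
    - by rewrite /p; lra.
    - by rewrite /p; lra.
    - near=> t.
      have : (P [set w | (X 0%N w < - t)%R] / P [set w | (t < X 0%N w)%R] <= C%:E)%E.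
        by near: t; exact: HC.
      have -> : P [set w | t < X 0%N w] = (tail F t)%:E.
        rewrite /tail fineK ?fin_num_measure//; congr (P _).
        by apply/seteqP; split=> w /=; rewrite in_itv/= andbT.
      by rewrite inver gt_eqF// lee_pdivrMr// -EFinM.
    by exists p, mp; split => //; rewrite /p; lra.
  have VE : ('V_P[X 0%N] = \int[F]_x (`|x| `^ 2)%:E)%E.
    rewrite ge0_integral_distribution//; last first.
      apply/measurable_EFinP; apply: (measurableT_comp (measurable_powR 2)).
      exact: normr_measurable.
    rewrite /variance unlock X_centered /= unlock.
    apply: eq_integral => w _ /=; congr EFin.
    by rewrite powR_mulrn// real_normK ?num_real// !fctE /= subr0 expr2.
  exists 2, (fine ('V_P[X 0%N])%E + 1).
  have V0 : (0 <= 'V_P[X 0%N])%E by exact: variance_ge0.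
  have Vf : ('V_P[X 0%N])%E \is a fin_num by rewrite ge0_fin_numE// ltey.
  split => //; first by rewrite ler1n.
  - exact: lt_le_trans gm m2.
  - by rewrite ltr_wpDl// fine_ge0.
  by rewrite -VE EFinD fineK// leeDl.
have ga : gamma < alpha by exact: lt_le_trans gm ma.
have fac n := iid_factorizes X_iid.1 n X_iid.2.
have Hq q q1 qa := @right_moment_finite R F alpha q T0 Trv q1 qa.
apply: cvg_ereal0 => e e0.
have /near_pinfty_ex[B B1 HB] :=
  near_relative_variance iF F0 p1 p2 ga gp alpha_gt1 mp0 Hp Hq T0 Trv e0.
near=> n.
have n0 : (0 < n)%N by near: n; exact: nbhs_infty_gt.
have nB : B <= n%:R `^ (beta + epsilon) by near: n; exact: near_nat_powR_ge.
apply/andP; split.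
  apply: (@le_trans _ _ (Var_Z F n (n%:R `^ (beta + epsilon) + 1) /
    P [set w | (n%:R `^ (beta + epsilon) + 1 < partial_sum X n w)%R] ^+ 2)%E).
    by rewrite mule_ge0 ?variance_ge0// inve_ge0 expe_ge0.
  by apply: ereal_sup_ubound; eexists; last reflexivity; rewrite /= ltrDl.
apply: ub_ereal_sup => _ [b /= nb <-].
apply: (HB b _ n n0 _ _ _ P (fun k : 'I_n => (X k : T -> R)) (fac n)).
- exact: le_trans nB (ltW nb).
- have -> : n%:R = (n%:R `^ (beta + epsilon)) `^ gamma.
    by rewrite -powRrM mulfV ?gt_eqF// powRr1.
  rewrite ge0_ler_powR ?nnegrE ?powR_ge0 ?invr_ge0 ?(ltW be0) ?(ltW nb)//.
  by rewrite (le_trans _ (ltW nb))// powR_ge0.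
Unshelve. all: end_near. Qed.
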